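(* For any integer $n\ge 0$, all of the following congruences hold: $$p_{-1/2}(7n+r) \equiv 0 \pmod{7}, \quad r \in \{2,4,5,6\};$$ $$p_{-1/2}(49n+r) \equiv 0 \pmod{49}, \quad r \in \{20,34,41,48\};$$ $$p_{-1/2}(17n+11) \equiv 0 \pmod{17};$$ $$p_{-1/2}(29n+26) \equiv 0 \pmod{29};$$ $$p_{-1/3}(5n+r) \equiv 0 \pmod{5}, \quad r\in \{2, 3, 4\};$$ $$p_{-1/3}(5n+3) \equiv 0 \pmod{25};$$ $$p_{-1/3}(19n+14) \equiv 0 \pmod{19};$$ $$p_{-1/3}(31n+28) \equiv 0 \pmod{31};$$ $$p_{-2/3}(5n+r) \equiv 0 \pmod{5}, \quad r\in \{3,4\};$$ $$p_{-2/3}(11n+r) \equiv 0 \pmod{11}, \quad r\in \{2,4,5,7,8,9\};$$ $$p_{-1/4}(5n+r) \equiv 0 \pmod{5}, \quad r\in \{3, 4\};$$ $$p_{-1/4}(13n+r) \equiv 0 \pmod{13}, \quad r \in \{4,5,7,8,9,11,12\};$$ $$p_{-3/4}(5n+r) \equiv 0 \pmod{5}, \quad r\in \{2, 3, 4\};$$ $$p_{-3/4}(43n+39) \equiv 0 \pmod{43};$$ $$p_{-3/4}(59n+24) \equiv 0 \pmod{59};$$ $$p_{-3/4}(107n+97) \equiv 0 \pmod{107};$$ $$p_{-1/5}(31n+23) \equiv 0 \pmod{31};$$ $$p_{-1/5}(71n+29) \equiv 0 \pmod{71};$$ $$p_{-1/5}(131n+119) \equiv 0 \pmod{131};$$ $$p_{-2/5}(7n+r)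 \equiv 0 \pmod{7}, \quad r\in \{3,4,6\};$$ $$p_{-2/5}(11n+9) \equiv 0 \pmod{11};$$ $$p_{-2/5}(17n+r) \equiv 0 \pmod{17}, \quad r\in \{2,5,7,8,9,12,13,14,16\};$$ $$p_{-3/5}(11n+8) \equiv 0 \pmod{11};$$ $$p_{-4/5}(11n+7) \equiv 0 \pmod{11};$$ $$p_{-4/5}(19n+r) \equiv 0 \pmod{19}, \quad r\in \{4,5,7,8,11,12,13,14,16,18\}.$$
   Context: For a rational number $k$, the rational numbers $p_k(n)$ ($n\ge 0$) are the coefficients of the power series $\sum_{n=0}^{\infty}p_{k}(n)q^n=(q;q)_{\infty}^{k}$, where $(q;q)_\infty=\prod_{m=1}^{\infty}(1-q^m)$ and the power is defined by $(q;q)_\infty^{k}=\prod_{m=1}^\infty(1-q^m)^{k}$, each factor being expanded by the generalized binomial theorem $(1-x)^k=\sum_{i\ge 0}\binom{k}{i}(-1)^i x^i$. A rational number $x$ whose reduced denominator is coprime to a positive integer $M$ satisfies $x\equiv 0\pmod M$ if $M$ divides the numerator of $x$ in reduced form. (When $k$ has reduced denominator $b$, every prime dividing the denominator of $p_k(n)$ divides $b$, so the congruences are meaningful.) *)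

(* Defs.v *)
From mathcomp Require Import all_boot all_order all_algebra.
Set Implicit Arguments.
Unset Strict Implicit.
Unset Printing Implicit Defensive.
Import Order.TTheory GRing.Theory Num.Theory.
Local Open Scope ring_scope.

(* MathComp has no formal power series: the series \sum_n (f n) q^n with
   rational coefficients is represented by its coefficient sequence f. *)
Definition fps := nat -> rat.

Definition fps_one : fps := fun n => (n == 0%N)%:R.

Definition fps_mul (f g : fps) : fps :=
  fun n => \sum_(i < n.+1) f i * g (n - i)%N.

Definition gbinom (k : rat) (i : nat) : rat :=
  (\prod_(j < i) (k - j%:R)) / (i`!)%:R.

(* (1 - q^m)^k = \sum_i gbinom k i * (-1)^i * q^(m * i), meant for m > 0. *)
Definition binom_series (k : rat) (m : nat) : fps :=
  fun n => if (m %| n)%N then gbinom k (n %/ m) * (-1) ^+ (n %/ m) else 0.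

(* (1 - q)^k (1 - q^2)^k ... (1 - q^N)^k *)
Fixpoint qpoch_pow_part (k : rat) (N : nat) : fps :=
  if N is N'.+1 then fps_mul (qpoch_pow_part k N') (binom_series k N'.+1)
  else fps_one.

(* The coefficient of q^n in the infinite product is the eventual value of the
   coefficient of q^n in the partial products; it is reached at N = n, see
   qpoch_pow_part_stable. *)
Definition p (k : rat) (n : nat) : rat := qpoch_pow_part k n n.

Lemma qpoch_pow_part_stable (k : rat) (n N : nat) :
  (n <= N)%N -> qpoch_pow_part k N n = p k n.
Proof.
elim: N => [|N IH]; first by rewrite leqn0 => /eqP ->.
rewrite leq_eqVlt => /orP [/eqP -> //|]; rewrite ltnS => le_nN.
rewrite -(IH le_nN) /= {1}/fps_mul big_ord_recr /= subnn big1 => [|i _].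
  by rewrite /binom_series dvdn0 div0n /gbinom big_ord0 fact0 divr1 add0r.
rewrite /binom_series gtnNdvd ?mulr0 ?subn_gt0 //.
by rewrite ltnS (leq_trans (leq_subr _ _)).
Qed.

Definition ratcong0 (M : nat) (x : rat) : Prop :=
  coprimez (denq x) M%:Z /\ (M%:Z %| numq x)%Z.

(* Main.v *)
(** Modulo l, p_k(n) depends only on k modulo a high power of l, so k may be replaced by a
    natural number K = d + l^e c; the l^e-th power of a series is, modulo l^e, supported on
    exponents divisible by l (its derivative vanishes), and everything is reduced to the
    coefficients of small powers of the Euler product E = (q;q)_oo.

    For d = 1, 3 one uses the identities of Euler and Jacobi.  For even d one has to show that
    theta^(l-1) fixes eta^d modulo l, where theta = q d/dq.  Ramanujan's differential equations
    for P, Q, R, which follow from divisor convolution sums, show that in characteristic l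
    theta maps forms of weight w to forms of weight w + 2l: by the Cohen-Kuznetsov expansion,
    theta^l f has a single nonzero term, and theta^l = theta.  Hence the claim is an identity
    between polynomials in Q, R of the same weight, and such a polynomial vanishes as soon as its
    first w/12 coefficients do, since Q^3 - R^2 divides any form without constant term.  This
    leaves a finite computation.

    Modulo 25 and 49 one dissects E by residue classes of exponents: Jacobi's identity gives
    polynomial relations between the components of E, which force the relevant component of
    E^8, resp. E^10, to be divisible by 125, resp. 49; E^24 is expressed modulo 49 through
    E^10, E^3 and E^7. *)

Require Import Defs.
From Stdlib Require BinInt.
From HB Require Import structures.
From mathcomp Require Import all_boot all_order all_algebra.
From mathcomp Require boolp.
From mathcomp Require Import zify ssrZ ring.
Import Order.TTheory GRing.Theory Num.Theory.
Local Open Scope ring_scope.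

Set Implicit Arguments.
Unset Strict Implicit.
Unset Printing Implicit Defensive.

(** The even d settled by computation are 4, 6, 8, 10, 14 and 26, all in Serre's list of even
    lacunary powers of eta, where the classical explanation is complex multiplication. Here only
    characteristic l is used. That the coefficients of E^d with l | 24n + d vanish modulo l says
    exactly that (24 theta + d)^(l-1) fixes E^d. Pulling E^d out of 24 theta + d leaves the operator
    24 theta + d P, and P is not modular. This is the obstacle; it disappears modulo l because P is
    the logarithmic derivative of the discriminant and theta preserves forms. The sharp weight shift
    l + 1 rests on E_(l-1) = 1 modulo l, hence on Bernoulli numbers; the cruder shift 2l comes for
    free from theta^l = theta and only lengthens the final computation. *)

Record series (R : Type) := Series { cf : nat -> R }.

Lemma series_ext (R : Type) (f g : series R) : cf f =1 cf g -> f = g.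
Proof. by case: f g => [f] [g] /= /boolp.funext ->. Qed.

HB.instance Definition _ (R : Type) := boolp.gen_eqMixin (series R).
HB.instance Definition _ (R : Type) := boolp.gen_choiceMixin (series R).

(** * Formal power series over a commutative ring *)

Section SeriesRing.
Variable R : comNzRingType.
Implicit Types f g h : series R.

Definition sadd f g := Series (fun n => cf f n + cf g n).
Definition sopp f := Series (fun n => - cf f n).
Definition sC (c : R) := Series (fun n => if n == 0%N then c else 0).
Definition smul f g := Series (fun n => \sum_(i < n.+1) cf f i * cf g (n - i)%N).

Fact saddA : associative sadd.
Proof. by move=> f g h; apply: series_ext => n /=; rewrite addrA. Qed.
Fact saddC : commutative sadd.
Proof. by move=> f g; apply: series_ext => n /=; rewrite addrC. Qed.
Fact sadd0 : left_id (sC 0) sadd.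
Proof. by move=> f; apply: series_ext => n /=; rewrite if_same add0r. Qed.
Fact saddN : left_inverse (sC 0) sopp sadd.
Proof. by move=> f; apply: series_ext => n /=; rewrite if_same addNr. Qed.

HB.instance Definition _ := GRing.isZmodule.Build (series R) saddA saddC sadd0 saddN.

Arguments smul : simpl never.

(** Coefficients up to n depend only on truncations; this transports associativity and commutativity
    from polynomials. *)
Lemma smul_coef_poly f g (p q : {poly R}) n :
  (forall i, (i <= n)%N -> cf f i = p`_i) ->
  (forall i, (i <= n)%N -> cf g i = q`_i) ->
  forall i, (i <= n)%N -> cf (smul f g) i = (p * q)`_i.
Proof.
move=> fp gq i le_in; rewrite coefM; apply: eq_bigr => j _; have jn := ltn_ord j.
by rewrite fp ?gq //; lia.
Qed.

Definition trunc n f : {poly R} := \poly_(i < n.+1) cf f i.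

Lemma coef_trunc n f i : (i <= n)%N -> cf f i = (trunc n f)`_i.
Proof. by move=> le_in; rewrite coef_poly ltnS le_in. Qed.

Fact smulA : associative smul.
Proof.
move=> f g h; apply: series_ext => n.
have t := @coef_trunc n.
rewrite (@smul_coef_poly _ _ (trunc n f) (trunc n g * trunc n h) n) //; last 2 first.
- by move=> i /t.
- by move=> i; apply: smul_coef_poly => j; apply: t.
rewrite (@smul_coef_poly _ _ (trunc n f * trunc n g) (trunc n h) n) ?mulrA //.
- by move=> i; apply: smul_coef_poly => j; apply: t.
- by move=> i /t.
Qed.

Fact smulC : commutative smul.
Proof.
move=> f g; apply: series_ext => n.
have t := @coef_trunc n.
rewrite (@smul_coef_poly _ _ (trunc n f) (trunc n g) n) //; try by move=> i /t.
rewrite (@smul_coef_poly _ _ (trunc n g) (trunc n f) n) 1?mulrC //; by move=> i /t.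
Qed.

Fact smul1 : left_id (sC 1) smul.
Proof.
move=> f; apply: series_ext => n /=.
by rewrite big_ord_recl /= mul1r subn0 big1 ?addr0 // => i _; rewrite mul0r.
Qed.

Fact smulDl : left_distributive smul +%R.
Proof.
move=> f g h; apply: series_ext => n /=.
by rewrite -big_split; apply: eq_bigr => i _; rewrite mulrDl.
Qed.

Fact s1_neq0 : sC 1 != 0.
Proof.
by apply/eqP => /(congr1 (fun f => cf f 0)) /= /eqP; rewrite oner_eq0.
Qed.

HB.instance Definition _ :=
  GRing.Zmodule_isComNzRing.Build (series R) smulA smulC smul1 smulDl s1_neq0.

Lemma cf0 n : cf (0 : series R) n = 0. Proof. by rewrite /= if_same. Qed.
Lemma cf1 n : cf (1 : series R) n = (n == 0%N)%:R.
Proof. by rewrite /=; case: (n == 0%N). Qed.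
Lemma cfD f g n : cf (f + g) n = cf f n + cf g n. Proof. by []. Qed.
Lemma cfN f n : cf (- f) n = - cf f n. Proof. by []. Qed.
Lemma cfB f g n : cf (f - g) n = cf f n - cf g n. Proof. by []. Qed.
Lemma cfM f g n : cf (f * g) n = \sum_(i < n.+1) cf f i * cf g (n - i)%N.
Proof. by []. Qed.

Lemma cf_sum I (r : seq I) P (F : I -> series R) n :
  cf (\sum_(i <- r | P i) F i) n = \sum_(i <- r | P i) cf (F i) n.
Proof. by apply: (big_morph (fun f => cf f n)) => //; rewrite cf0. Qed.
Lemma cfMn f k n : cf (f *+ k) n = cf f n *+ k.
Proof. by elim: k => [|k IH]; rewrite ?mulr0n ?cf0 // !mulrS cfD IH. Qed.

Lemma cfM0 f g : cf (f * g) 0 = cf f 0 * cf g 0.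
Proof. by rewrite cfM big_ord1. Qed.
Lemma cfX0 f k : cf (f ^+ k) 0 = cf f 0 ^+ k.
Proof. by elim: k => [|k IH]; rewrite ?cf1 // !exprS cfM0 IH. Qed.

Fact sC_is_zmod : zmod_morphism sC.
Proof.
by move=> a b; apply: series_ext => n; rewrite cfB /=; case: eqP; rewrite ?subr0.
Qed.
HB.instance Definition _ := GRing.isZmodMorphism.Build R (series R) sC sC_is_zmod.

Lemma cf_sCM c f n : cf (sC c * f) n = c * cf f n.
Proof.
rewrite cfM big_ord_recl /= subn0 big1 ?addr0 // => i _.
by rewrite mul0r.
Qed.

Fact sC_is_monoid : monoid_morphism sC.
Proof.
split=> // a b; apply: series_ext => n; rewrite cf_sCM /=.
by case: eqP; rewrite ?mulr0.
Qed.
HB.instance Definition _ := GRing.isMonoidMorphism.Build R (series R) sC sC_is_monoid.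

Lemma cf_natr k n : cf (k%:R : series R) n = if n == 0%N then k%:R else 0.
Proof. by rewrite -[k%:R](rmorph_nat sC). Qed.

Lemma cf_natrM k f n : cf (k%:R * f) n = k%:R * cf f n.
Proof. by rewrite -(rmorph_nat sC) cf_sCM. Qed.

(** * Agreement modulo q^N *)

Definition eqm N f g := forall n, (n < N)%N -> cf f n = cf g n.

Lemma eqm_refl N f : eqm N f f. Proof. by []. Qed.
Lemma eqm_sym N f g : eqm N f g -> eqm N g f.
Proof. by move=> fg n /fg. Qed.
Lemma eqm_trans N g f h : eqm N f g -> eqm N g h -> eqm N f h.
Proof. by move=> fg gh n nN; rewrite fg ?gh. Qed.
Lemma eqm_le M N f g : (M <= N)%N -> eqm N f g -> eqm M f g.
Proof. by move=> MN fg n nM; apply: fg; apply: leq_trans MN. Qed.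
Lemma eqmD N f g f' g' : eqm N f f' -> eqm N g g' -> eqm N (f + g) (f' + g').
Proof. by move=> ff gg n nN; rewrite !cfD ff ?gg. Qed.
Lemma eqmM N f g f' g' : eqm N f f' -> eqm N g g' -> eqm N (f * g) (f' * g').
Proof.
move=> ff gg n nN; rewrite !cfM; apply: eq_bigr => i _; have := ltn_ord i.
by move=> ?; rewrite ff ?gg //; lia.
Qed.
Lemma eqmX N f f' k : eqm N f f' -> eqm N (f ^+ k) (f' ^+ k).
Proof. by move=> ff; elim: k => // k IH; rewrite !exprS; apply: eqmM. Qed.
Lemma eqm_sum N I (r : seq I) (P : pred I) (F G : I -> series R) :
  (forall i, P i -> eqm N (F i) (G i)) ->
  eqm N (\sum_(i <- r | P i) F i) (\sum_(i <- r | P i) G i).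
Proof. by move=> FG n nN; rewrite !cf_sum; apply: eq_bigr => i /FG ->. Qed.
Lemma eqm_all f g : (forall N, eqm N f g) -> f = g.
Proof. by move=> fg; apply: series_ext => n; apply: (fg n.+1). Qed.

(** * Monomials and regular elements *)

Definition qv : series R := Series (fun n => (n == 1%N)%:R).

Lemma cf_qvXM k f n : cf (qv ^+ k * f) n = if (n < k)%N then 0 else cf f (n - k).
Proof.
elim: k n f => [|k IH] n f; first by rewrite mul1r subn0.
rewrite exprS -mulrA; case: n => [|n].
  by rewrite cfM big_ord1 mul0r.
rewrite ltnS subSS -IH; move: (qv ^+ k * f) => g.
rewrite cfM big_ord_recl big_ord_recl mul0r add0r mul1r /bump /= subn1 big1 ?addr0 // => i _.
exact: mul0r.
Qed.

Lemma cf_qvX k n : cf (qv ^+ k) n = (n == k)%:R.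
Proof.
rewrite -[qv ^+ k]mulr1 cf_qvXM cf1.
by case: ltngtP => [||->]; rewrite ?subnn // => lt; rewrite subn_eq0 leqNgt lt.
Qed.

Lemma eqm_qvX N k f : (N <= k)%N -> eqm N (qv ^+ k * f) 0.
Proof. by move=> Nk n nN; rewrite cf_qvXM cf0 (leq_trans nN Nk). Qed.

(** Cancelling a factor of order v with regular leading coefficient costs v terms of precision: once
    the lower terms of g vanish, the coefficient n + v of the product is f_v g_n. *)
Lemma eqm_order v N f g :
  (forall i, (i < v)%N -> cf f i = 0) -> GRing.lreg (cf f v) ->
  eqm (N + v) (f * g) 0 -> eqm N g 0.
Proof.
move=> fv reg fg0; apply: ltn_ind => n IH nN; rewrite cf0; apply/eqP.
rewrite -(mulrI_eq0 _ reg); apply/eqP.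
have : cf (f * g) (n + v) = 0 by rewrite fg0 ?cf0 // ltn_add2r.
have vn : (v < (n + v).+1)%N by lia.
rewrite cfM (bigD1 (Ordinal vn)) //= addnK big1 ?addr0 // => i /eqP niv.
have ile := ltn_ord i.
case: (ltngtP i v) => [/fv ->|lt|eq]; rewrite ?mul0r //.
  by rewrite IH ?cf0 ?mulr0 //; lia.
by case: niv; apply: val_inj.
Qed.

Lemma lreg_order v f :
  (forall i, (i < v)%N -> cf f i = 0) -> GRing.lreg (cf f v) -> GRing.lreg f.
Proof.
move=> fv reg; apply/mulrI0_lreg => g fg0; apply: eqm_all => N.
by apply: (eqm_order fv reg); rewrite fg0.
Qed.

Lemma lreg_const1 f : cf f 0 = 1 -> GRing.lreg f.
Proof. by move=> f0; apply: (@lreg_order 0) => //; rewrite f0; apply: lreg1. Qed.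

Lemma eqm_lreg N f g h : GRing.lreg (cf f 0) -> eqm N (f * g) (f * h) -> eqm N g h.
Proof.
move=> reg fg; apply: ltn_ind => n IH nN; apply: reg.
move: (fg n nN); rewrite !cfM !big_ord_recl /= !subn0 => /eqP.
set x := \sum_(i < n) _; set y := \sum_(i < n) _.
suff -> : x = y by move/eqP/addIr.
by apply: eq_bigr => i _; have := ltn_ord i; rewrite /bump /= => ?; rewrite IH //; lia.
Qed.

(** * The derivation q d/dq *)

Definition theta f := Series (fun n => n%:R * cf f n).

Lemma cf_theta f n : cf (theta f) n = n%:R * cf f n. Proof. by []. Qed.

Fact theta_is_zmod : zmod_morphism theta.
Proof. by move=> f g; apply: series_ext => n /=; rewrite mulrBr. Qed.
HB.instance Definition _ :=
  GRing.isZmodMorphism.Build (series R) (series R) theta theta_is_zmod.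

Lemma thetaD f g : theta (f + g) = theta f + theta g. Proof. exact: raddfD. Qed.
Lemma thetaB f g : theta (f - g) = theta f - theta g. Proof. exact: raddfB. Qed.

Lemma thetaM f g : theta (f * g) = theta f * g + f * theta g.
Proof.
apply: series_ext => n; rewrite cfD !cfM cf_theta cfM mulr_sumr -big_split.
apply: eq_bigr => i _; rewrite !cf_theta.
have {1}-> : n = (i + (n - i))%N by have := ltn_ord i; lia.
by rewrite natrD /=; ring.
Qed.

Lemma theta_sC c : theta (sC c) = 0.
Proof. by apply: series_ext => -[|n]; rewrite cf0 /= ?mul0r ?mulr0. Qed.
Lemma theta1 : theta 1 = 0. Proof. exact: theta_sC. Qed.
Lemma theta_nat k : theta k%:R = 0.
Proof. by rewrite -(rmorph_nat sC) theta_sC. Qed.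
Lemma theta_sCM c f : theta (sC c * f) = sC c * theta f.
Proof. by rewrite thetaM theta_sC mul0r add0r. Qed.
Lemma theta_natM k f : theta (k%:R * f) = k%:R * theta f.
Proof. by rewrite thetaM theta_nat mul0r add0r. Qed.

Lemma thetaX f k : theta (f ^+ k.+1) = k.+1%:R * f ^+ k * theta f.
Proof.
elim: k => [|k IH]; first by rewrite expr1 expr0 !mul1r.
by rewrite exprS thetaM IH -[k.+2]addn1 natrD exprS; ring.
Qed.

Lemma cf_iter_theta f k n : cf (iter k theta f) n = n%:R ^+ k * cf f n.
Proof. by elim: k => [|k IH]; rewrite ?mul1r //= IH exprS mulrA. Qed.

End SeriesRing.

Arguments qv {R}.
Arguments theta {R} f.
Arguments sC {R} c.

Section Map.
Variables (R S : comNzRingType) (phi : {rmorphism R -> S}).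

Definition smap (f : series R) : series S := Series (fun n => phi (cf f n)).

Fact smap_is_zmod : zmod_morphism smap.
Proof. by move=> f g; apply: series_ext => n /=; rewrite rmorphB. Qed.
HB.instance Definition _ :=
  GRing.isZmodMorphism.Build (series R) (series S) smap smap_is_zmod.

Fact smap_is_monoid : monoid_morphism smap.
Proof.
split=> [|f g]; apply: series_ext => n /=.
  by case: eqP; rewrite ?rmorph1 ?rmorph0.
by rewrite rmorph_sum; apply: eq_bigr => i _; rewrite rmorphM.
Qed.
HB.instance Definition _ :=
  GRing.isMonoidMorphism.Build (series R) (series S) smap smap_is_monoid.

Lemma cf_smap f n : cf (smap f) n = phi (cf f n). Proof. by []. Qed.

Lemma smap_qv : smap qv = qv.
Proof. by apply: series_ext => n /=; rewrite rmorph_nat. Qed.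

Lemma smap_theta f : smap (theta f) = theta (smap f).
Proof. by apply: series_ext => n /=; rewrite rmorphM rmorph_nat. Qed.

End Map.

Lemma reindex_on (V : nmodType) (I J : finType) (P : pred I) (Q : pred J)
    (h : I -> J) (h' : J -> I) (F : J -> V) :
  (forall i, P i -> Q (h i) /\ h' (h i) = i) ->
  (forall j, Q j -> P (h' j) /\ h (h' j) = j) ->
  \sum_(j | Q j) F j = \sum_(i | P i) F (h i).
Proof.
move=> PQ QP; rewrite (reindex_onto h h') => [|j /QP[] //].
apply: eq_bigl => i; apply/andP/idP => [[/QP[Ph _] /eqP <-]|/PQ[-> ->]] //.
Qed.

(** * Liouville's method: sums over the solutions of ax + by = n *)

Section Quadruples.
Variable n : nat.
Implicit Type t : 'I_n.+1 * 'I_n.+1 * 'I_n.+1 * 'I_n.+1.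

Definition ta t : nat := t.1.1.1.
Definition tb t : nat := t.1.1.2.
Definition tx t : nat := t.1.2.
Definition ty t : nat := t.2.

Definition qsol t :=
  [&& (0 < ta t)%N, (0 < tb t)%N, (0 < tx t)%N, (0 < ty t)%N
    & (ta t * tx t + tb t * ty t == n)%N].

(** [inord] falls back to 0 out of range, but in a positive solution all four entries are at most n
    ([mktE]). *)
Definition mkt (a b x y : nat) : 'I_n.+1 * 'I_n.+1 * 'I_n.+1 * 'I_n.+1 :=
  (inord a, inord b, inord x, inord y).

Lemma mktE a b x y : (0 < a)%N -> (0 < b)%N -> (0 < x)%N -> (0 < y)%N ->
  (a * x + b * y = n)%N ->
  [/\ ta (mkt a b x y) = a, tb (mkt a b x y) = b, tx (mkt a b x y) = x,
      ty (mkt a b x y) = y & qsol (mkt a b x y)].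
Proof.
move=> a0 b0 x0 y0 e.
have [ale ble xle yle] : [/\ a < n.+1, b < n.+1, x < n.+1 & y < n.+1]%N.
  by split; nia.
by rewrite /qsol /ta /tb /tx /ty /= !inordK // a0 b0 x0 y0 e eqxx.
Qed.

Lemma mkt_id t a b x y : ta t = a -> tb t = b -> tx t = x -> ty t = y ->
  mkt a b x y = t.
Proof.
case: t => [[[a' b'] x'] y'] <- <- <- <-.
by rewrite /mkt /ta /tb /tx /ty /= !inord_val.
Qed.

Definition qsum (P : pred _) (u : int -> int -> int) : int :=
  \sum_(t | qsol t && P t) u (ta t)%:Z (tb t)%:Z.

Variables g h : int -> int -> int.
Hypothesis g_sym : forall a b, g a b = g b a.
Hypothesis h_sym : forall a b, h a b = h b a.
Hypothesis gh : forall a b, h a b = g (a + b) b - g a b.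

(* (a, b, x, y) |-> (a - b, b, x, x + y) preserves ax + by *)
Lemma sum_shear u :
  qsum (fun t => (tb t < ta t)%N) u =
  qsum (fun t => (tx t < ty t)%N) (fun a b => u (a + b) b).
Proof.
rewrite /qsum (reindex_on (P := fun t => qsol t && (tx t < ty t)%N)
  (h := fun t => mkt (ta t + tb t) (tb t) (tx t) (ty t - tx t))
  (h' := fun t => mkt (ta t - tb t) (tb t) (tx t) (tx t + ty t))).
- apply: eq_bigr => t /andP[/and5P[a0 b0 x0 y0 /eqP e] lt].
  by case: (@mktE (ta t + tb t) (tb t) (tx t) (ty t - tx t)) => [|||||-> -> _ _ _];
    rewrite ?PoszD //; nia.
- move=> t /andP[/and5P[a0 b0 x0 y0 /eqP e] lt].
  case: (@mktE (ta t + tb t) (tb t) (tx t) (ty t - tx t)) => [|||||-> -> -> -> ->];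
    [nia..|split; first by lia].
  by apply: mkt_id; lia.
- move=> t /andP[/and5P[a0 b0 x0 y0 /eqP e] lt].
  case: (@mktE (ta t - tb t) (tb t) (tx t) (tx t + ty t)) => [|||||-> -> -> -> ->];
    [nia..|split; first by lia].
  by apply: mkt_id; lia.
Qed.

Lemma sum_swap (P Q : pred _) u :
  (forall t, P (mkt (tb t) (ta t) (ty t) (tx t)) = Q t) ->
  (forall a b, u a b = u b a) -> qsum P u = qsum Q u.
Proof.
move=> PQ uC; have K t : mkt (tb (mkt (tb t) (ta t) (ty t) (tx t)))
  (ta (mkt (tb t) (ta t) (ty t) (tx t))) (ty (mkt (tb t) (ta t) (ty t) (tx t)))
  (tx (mkt (tb t) (ta t) (ty t) (tx t))) = t.
  case: t => [[[a b] x] y].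
  by rewrite /mkt /ta /tb /tx /ty /= !inord_val.
have E t : qsol (mkt (tb t) (ta t) (ty t) (tx t)) = qsol t.
  case: t => [[[a b] x] y].
  rewrite /qsol /mkt /ta /tb /tx /ty /= !inord_val addnC.
  by case: (0 < a)%N (0 < b)%N (0 < x)%N (0 < y)%N => [] [] [] [].
rewrite /qsum (reindex_on (P := fun t => qsol t && Q t)
  (h := fun t => mkt (tb t) (ta t) (ty t) (tx t))
  (h' := fun t => mkt (tb t) (ta t) (ty t) (tx t))).
- apply: eq_bigr => t /andP[/and5P[a0 b0 x0 y0 /eqP e] lt].
  by case: (@mktE (tb t) (ta t) (ty t) (tx t)) => [|||||-> -> _ _ _] //; lia.
- by move=> t; rewrite E PQ => ->; rewrite K.
- by move=> t /andP[qt Pt]; rewrite E -PQ K qt Pt.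
Qed.

Lemma sum_split (x y : _ -> nat) u :
  qsum xpredT u = qsum (fun t => (x t < y t)%N) u + qsum (fun t => (y t < x t)%N) u
    + qsum (fun t => x t == y t) u.
Proof.
rewrite /qsum (bigID (fun t => x t < y t)%N) /= -addrA; congr (_ + _).
  by apply: eq_bigl => t; rewrite andbT.
rewrite (bigID (fun t => x t == y t)) /= addrC; congr (_ + _).
  by apply: eq_bigl => t; case: (ltngtP (x t) (y t)); rewrite ?andbF ?andbT.
by apply: eq_bigl => t; case: (ltngtP (x t) (y t)); rewrite ?andbF ?andbT.
Qed.

(** The total of g is computed twice, split by the order of a, b and by the order of x, y. Swapping
    makes the two halves of each split equal, and the shear turns the half a > b of g into the half
    x < y of g(a + b, b). In the sum of h everything cancels except the two diagonals. *)
Lemma sum_shear_id :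
  qsum xpredT h = qsum (fun t => tx t == ty t) (fun a b => g (a + b) b)
    - qsum (fun t => ta t == tb t) g.
Proof.
have swap_ord t : [/\ ta (mkt (tb t) (ta t) (ty t) (tx t)) = tb t,
    tb (mkt (tb t) (ta t) (ty t) (tx t)) = ta t,
    tx (mkt (tb t) (ta t) (ty t) (tx t)) = ty t &
    ty (mkt (tb t) (ta t) (ty t) (tx t)) = tx t].
  case: t => [[[a b] x] y].
  by rewrite /mkt /ta /tb /tx /ty /= !inord_val.
have swA u : (forall a b, u a b = u b a) ->
    qsum (fun t => (ta t < tb t)%N) u = qsum (fun t => (tb t < ta t)%N) u.
  by apply: sum_swap => t; case: (swap_ord t) => -> ->.
have swX u : (forall a b, u a b = u b a) ->
    qsum (fun t => (ty t < tx t)%N) u = qsum (fun t => (tx t < ty t)%N) u.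
  by apply: sum_swap => t; case: (swap_ord t) => _ _ -> ->.
have sumB P : qsum P h = qsum P (fun a b => g (a + b) b) - qsum P g.
  by rewrite /qsum -sumrB; apply: eq_bigr => t _; rewrite gh.
have gA := sum_split ta tb g; have gX := sum_split tx ty g.
rewrite swA // in gA; rewrite swX // in gX.
rewrite (sum_split tx ty) swX // !sumB -(sum_shear g).
move: gX; rewrite gA.
set S := qsum _ g; set A := qsum _ g; set X := qsum _ g; set C := qsum _ g.
set D := qsum _ _ => e.
by transitivity ((S + S + A) - (X + X + C) + D - A); [|rewrite e]; ring.
Qed.

End Quadruples.

Arguments qsum : clear implicits.

Definition sigma (i k : nat) : int :=
  \sum_(a < k.+1 | (0 < a)%N && (a %| k)%N) (a : nat)%:Z ^+ i.

Lemma sigma_widen i k n : (0 < k <= n)%N ->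
  sigma i k = \sum_(a < n.+1 | (0 < a)%N && (a %| k)%N) (a : nat)%:Z ^+ i.
Proof.
move=> /andP[k0 kn]; rewrite /sigma.
rewrite (big_ord_widen_cond n.+1 (fun a => (0 < a)%N && (a %| k)%N)
  (fun a => a%:Z ^+ i)) //.
apply: eq_bigl => a; case: (boolP (a %| k)%N); rewrite ?andbF //= => /dvdn_leq.
by move/(_ k0); rewrite ltnS => ->; rewrite !andbT.
Qed.

Lemma sigma0 i : sigma i 0 = 0.
Proof. by rewrite /sigma big1 // => a; have := ltn_ord a; lia. Qed.

Section QsumFormulas.
Variable n : nat.

(** A solution is a splitting of n into k = ax and n - k = by, that is, a divisor a of k and a
    divisor b of n - k. *)
Lemma qsum_conv i j :
  qsum n xpredT (fun a b => a ^+ i * b ^+ j) =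
  \sum_(k < n.+1) sigma i k * sigma j (n - k).
Proof.
rewrite (bigID (fun k : 'I_n.+1 => 0 < k < n)%N) /= [X in _ + X]big1 ?addr0; last first.
  move=> k; have := ltn_ord k; case: (posnP k) => [->|k0]; first by rewrite sigma0 mul0r.
  move=> kn; have [->|nk] : (n - k = 0 \/ k < n)%N by lia.
    by rewrite sigma0 mulr0.
  by rewrite nk.
under eq_bigr => k /andP[k0 kn].
  rewrite (@sigma_widen i k n) ?k0 1?ltnW // (@sigma_widen j (n - k) n); last by lia.
  rewrite big_distrlr /=.
  over.
under eq_bigr => k _.
  rewrite pair_big.
  over.
rewrite pair_big_dep /qsum /=; symmetry.
rewrite (reindex_on (I := ('I_n.+1 * 'I_n.+1 * 'I_n.+1 * 'I_n.+1)%type)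
  (J := ('I_n.+1 * ('I_n.+1 * 'I_n.+1))%type) (P := fun t => qsol t && true)
  (h := fun t => (inord (ta t * tx t), (t.1.1.1, t.1.1.2)))
  (h' := fun s => mkt n s.2.1 s.2.2 (s.1 %/ s.2.1) ((n - s.1) %/ s.2.2))) //.
- move=> t; rewrite andbT => qt; have /and5P[a0 b0 x0 y0 /eqP e] := qt.
  rewrite /= inordK; last by nia.
  have eb : (n - ta t * tx t = tb t * ty t)%N by lia.
  rewrite !eb -/(ta t) -/(tb t) !dvdn_mulr // !mulKn // a0 b0; split; first by nia.
  exact: mkt_id.
- move=> [k [a b]] /= /andP[/andP[k0 kn] /andP[/andP[a0 ak] /andP[b0 bk]]].
  have e1 := divnK ak; have e2 := divnK bk.
  have x0 : (0 < k %/ a)%N by rewrite divn_gt0 // dvdn_leq.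
  have y0 : (0 < (n - k) %/ b)%N by rewrite divn_gt0 // dvdn_leq ?subn_gt0.
  case: (@mktE n a b (k %/ a) ((n - k) %/ b)) => [|||||ea eb ex ey ->] //.
    by rewrite ![(_ * (_ %/ _))%N]mulnC e1 e2; lia.
  split=> //; rewrite ea ex mulnC e1.
  by rewrite inord_val !inord_val.
Qed.

(** If x = y then (a + b)x = n, so c = a + b is a divisor of n and b ranges over 0 < b < c. *)
Lemma qsum_diag_x (u : int -> int -> int) :
  qsum n (fun t : 'I_n.+1 * 'I_n.+1 * 'I_n.+1 * 'I_n.+1 => tx t == ty t)
    (fun a b => u (a + b) b) =
  \sum_(c < n.+1 | (0 < c)%N && (c %| n)%N)
    \sum_(b < c | (0 < b)%N) u (c : nat)%:Z (b : nat)%:Z.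
Proof.
have W (c : 'I_n.+1) : \sum_(b < c | (0 < b)%N) u (c : nat)%:Z (b : nat)%:Z =
    \sum_(b < n.+1 | (0 < b < c)%N) u (c : nat)%:Z (b : nat)%:Z.
  rewrite (big_ord_widen_cond n.+1 (fun b => (0 < b)%N) (fun b => u _ b%:Z)) //.
  by apply: ltnW.
under eq_bigr => c _ do rewrite W.
rewrite pair_big_dep /qsum /=; symmetry.
rewrite (reindex_on (I := ('I_n.+1 * 'I_n.+1 * 'I_n.+1 * 'I_n.+1)%type)
  (J := ('I_n.+1 * 'I_n.+1)%type) (P := fun t => qsol t && (tx t == ty t))
  (h := fun t => (inord (ta t + tb t), t.1.1.2))
  (h' := fun s => mkt n (s.1 - s.2) s.2 (n %/ s.1) (n %/ s.1))) //.
- apply: eq_bigr => t /andP[/and5P[a0 b0 x0 y0 /eqP e] /eqP xy].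
  by rewrite /= inordK ?PoszD //; nia.
- move=> t /andP[/and5P[a0 b0 x0 y0 /eqP e] /eqP xy].
  rewrite -xy in e; have {}e : ((ta t + tb t) * tx t = n)%N by lia.
  rewrite /= inordK; last by nia.
  have ab0 : (0 < ta t + tb t)%N by lia.
  have cn : (ta t + tb t %| n)%N by apply/dvdnP; exists (tx t); lia.
  have -> : (n %/ (ta t + tb t) = tx t)%N.
    by rewrite -{1}e mulKn.
  rewrite -/(tb t); split; first by lia.
  by apply: mkt_id; rewrite // addnK.
- move=> [c b] /= /andP[/andP[c0 cn] /andP[b0 bc]].
  have n0 : (0 < n)%N by have := ltn_ord c; lia.
  have e := divnK cn; have x0 : (0 < n %/ c)%N by rewrite divn_gt0 // dvdn_leq.
  case: (@mktE n (c - b) b (n %/ c) (n %/ c)) => [|||||ea eb ex ey ->] //; try nia.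
  by rewrite ex ey eqxx ea eb subnK ?(ltnW bc) // !inord_val.
Qed.

(** If a = b then a(x + y) = n, which leaves n/a - 1 choices of x. *)
Lemma qsum_diag_a (u : int -> int -> int) :
  qsum n (fun t : 'I_n.+1 * 'I_n.+1 * 'I_n.+1 * 'I_n.+1 => ta t == tb t) u =
  \sum_(a < n.+1 | (0 < a)%N && (a %| n)%N)
    ((n %/ a)%:Z - 1) * u (a : nat)%:Z (a : nat)%:Z.
Proof.
case: (posnP n) => [n0|n0].
  rewrite /qsum [RHS]big1 ?big1 // => [t /andP[/and5P[a0 _ _ _ _] _]|a].
    by have := ltn_ord t.1.1.1; rewrite -/(ta t); lia.
  by have := ltn_ord a; lia.
have W (a : 'I_n.+1) : (0 < a)%N && (a %| n)%N ->
    ((n %/ a)%:Z - 1) * u (a : nat)%:Z (a : nat)%:Z =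
    \sum_(x < n.+1 | (0 < x < n %/ a)%N) u (a : nat)%:Z (a : nat)%:Z.
  move=> /andP[a0 an].
  have x0 : (0 < n %/ a)%N by rewrite divn_gt0 // dvdn_leq.
  rewrite -(big_ord_widen_cond n.+1 (fun b => (0 < b)%N)
    (fun=> u (a : nat)%:Z (a : nat)%:Z)); last by rewrite ltnW // ltnS leq_div.
  case: (n %/ a)%N x0 => // m _; rewrite big_mkcond big_ord_recl /= add0r.
  rewrite (eq_bigr (fun=> u (a : nat)%:Z (a : nat)%:Z)) // sumr_const card_ord.
  by rewrite -mulr_natl -natz mulrSr addrK.
under [RHS]eq_bigr => a H do rewrite W //.
rewrite pair_big_dep /qsum /=; symmetry.
rewrite (reindex_on (I := ('I_n.+1 * 'I_n.+1 * 'I_n.+1 * 'I_n.+1)%type)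
  (J := ('I_n.+1 * 'I_n.+1)%type) (P := fun t => qsol t && (ta t == tb t))
  (h := fun t => (t.1.1.1, t.1.2))
  (h' := fun s => mkt n s.1 s.1 s.2 (n %/ s.1 - s.2))) //.
- by apply: eq_bigr => t /andP[_ /eqP ab]; rewrite /= -ab.
- move=> t /andP[/and5P[a0 b0 x0 y0 /eqP e] /eqP ab]; rewrite /=.
  rewrite -/(ta t) -/(tx t); rewrite -ab in e.
  have {}e : (ta t * (tx t + ty t) = n)%N by lia.
  have an : (ta t %| n)%N by apply/dvdnP; exists (tx t + ty t)%N; lia.
  have -> : (n %/ ta t = tx t + ty t)%N by rewrite -{1}e mulKn.
  by split; [lia|apply: mkt_id; rewrite // addKn].
- move=> [a x] /= /andP[/andP[a0 an] /andP[y0 yn]].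
  have e := divnK an.
  case: (@mktE n a a x (n %/ a - x)) => [|||||ea eb ex ey ->] //; try nia.
  by rewrite ea eb eqxx !inord_val.
Qed.

(** The factor [k] clears the denominators in the power-sum formulas behind the closed form [F]. *)
Lemma divisor_convolution (g h : int -> int -> int) (k : int) (F : int -> int) :
  (forall a b, g a b = g b a) -> (forall a b, h a b = h b a) ->
  (forall a b, h a b = g (a + b) b - g a b) ->
  (forall c : nat, (0 < c)%N -> k * \sum_(b < c | (0 < b)%N) g c%:Z (b : nat)%:Z = F c%:Z) ->
  k * qsum n xpredT h =
  \sum_(c < n.+1 | (0 < c)%N && (c %| n)%N)
    (F (c : nat)%:Z - k * ((n %/ c)%:Z - 1) * g (c : nat)%:Z (c : nat)%:Z).
Proof.
move=> gs hs gh poly.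
rewrite (@sum_shear_id n g h) // qsum_diag_x qsum_diag_a mulrBr !mulr_sumr -sumrB.
by apply: eq_bigr => c /andP[c0 _]; rewrite poly // mulrA.
Qed.

End QsumFormulas.

Lemma divn_mulz (n c : nat) : (c %| n)%N -> (n %/ c)%:Z * c%:Z = n%:Z.
Proof. by move=> cn; rewrite -PoszM divnK. Qed.

Lemma sum_pos_ord (F : nat -> int) c : (0 < c)%N ->
  \sum_(b < c | (0 < b)%N) F b = \sum_(0 <= b < c) F b - F 0%N.
Proof.
case: c => // c _; rewrite big_mkcond big_ord_recl /= add0r.
by rewrite big_nat_recl // addrC addKr big_mkord.
Qed.

(** * The convolution identities behind Ramanujan's equations *)

Section Convolutions.
Variable n : nat.
Local Notation "i ** j" := (\sum_(k < n.+1) sigma i k * sigma j (n - k)) (at level 40).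

Lemma convC i j : i ** j = j ** i.
Proof.
rewrite (reindex_inj rev_ord_inj); apply: eq_bigr => k _ /=.
by rewrite mulrC subSS subKn // -ltnS.
Qed.

(** The polynomial a^2 - ab + b^2 is chosen because its difference under a -> a + b is the symmetric
    monomial 2ab; the polynomials in the next lemmas are found in the same way. *)
Lemma conv_1_1 :
  12 * (1 ** 1) = 5 * sigma 3 n + sigma 1 n - 6 * n%:Z * sigma 1 n.
Proof.
unshelve epose proof (@divisor_convolution n (fun a b => a ^+ 2 - a * b + b ^+ 2)
  (fun a b => 2 * (a * b)) 6 (fun c => 5 * c ^+ 3 - 6 * c ^+ 2 + c) _ _ _ _) as E;
  [move=> a b /=; ring|move=> a b /=; ring|move=> a b /=; ring|move=> c c0|].
  rewrite (sum_pos_ord (fun b => c%:Z ^+ 2 - c%:Z * b%:Z + b%:Z ^+ 2)) // mulrBr.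
  (* The upper limit m is separated from the parameter c to make the induction possible. *)
  have P : forall m : nat, 6 * \sum_(0 <= b < m) (c%:Z ^+ 2 - c%:Z * b%:Z + b%:Z ^+ 2) =
    6 * m%:Z * c%:Z ^+ 2 - 3 * c%:Z * m%:Z * (m%:Z - 1)
    + (m%:Z - 1) * m%:Z * (2 * m%:Z - 1).
    elim=> [|m IH]; first by rewrite big_geq //; ring.
    by rewrite big_nat_recr //= mulrDr IH intS; ring.
  by rewrite P; ring.
have <- : qsum n xpredT (fun a b => a ^+ 1 * b ^+ 1) = 1 ** 1 by exact: qsum_conv.
move: E; rewrite /qsum -mulr_sumr => E.
rewrite (_ : 12 = 6 * 2) // -mulrA E /sigma !mulr_sumr -sumrN -!big_split /=.
apply: eq_bigr => c /andP[_ cn]; rewrite -(divn_mulz cn); ring.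
Qed.

Lemma conv_1_3 :
  240 * (1 ** 3) = 21 * sigma 5 n + 10 * sigma 3 n - sigma 1 n - 30 * n%:Z * sigma 3 n.
Proof.
unshelve epose proof (@divisor_convolution n
  (fun a b => a ^+ 4 + b ^+ 4 - 2 * (a ^+ 3 * b + a * b ^+ 3) + 3 * a ^+ 2 * b ^+ 2)
  (fun a b => 4 * (a ^+ 3 * b ^+ 1) + 4 * (a ^+ 1 * b ^+ 3)) 30
  (fun c => 21 * c ^+ 5 - 30 * c ^+ 4 + 10 * c ^+ 3 - c) _ _ _ _) as E;
  [move=> a b /=; ring|move=> a b /=; ring|move=> a b /=; ring|move=> c c0|].
  rewrite (sum_pos_ord (fun b => c%:Z ^+ 4 + b%:Z ^+ 4
    - 2 * (c%:Z ^+ 3 * b%:Z + c%:Z * b%:Z ^+ 3) + 3 * c%:Z ^+ 2 * b%:Z ^+ 2)) // mulrBr.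
  have P : forall m : nat, 30 * \sum_(0 <= b < m) (c%:Z ^+ 4 + b%:Z ^+ 4
      - 2 * (c%:Z ^+ 3 * b%:Z + c%:Z * b%:Z ^+ 3) + 3 * c%:Z ^+ 2 * b%:Z ^+ 2) =
    30 * m%:Z * c%:Z ^+ 4
    + (m%:Z - 1) * m%:Z * (2 * m%:Z - 1) * (3 * m%:Z ^+ 2 - 3 * m%:Z - 1)
    - 30 * c%:Z ^+ 3 * m%:Z * (m%:Z - 1) - 15 * c%:Z * m%:Z ^+ 2 * (m%:Z - 1) ^+ 2
    + 15 * c%:Z ^+ 2 * (m%:Z - 1) * m%:Z * (2 * m%:Z - 1).
    elim=> [|m IH]; first by rewrite big_geq //; ring.
    by rewrite big_nat_recr //= mulrDr IH intS; ring.
  by rewrite P; ring.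
move: E; rewrite /qsum big_split /= -!mulr_sumr -/(qsum n xpredT (fun a b => a ^+ 3 * b ^+ 1)).
rewrite -/(qsum n xpredT (fun a b => a ^+ 1 * b ^+ 3)) !qsum_conv convC => E.
transitivity (30 * (4 * (1 ** 3) + 4 * (1 ** 3))); first ring.
rewrite E /sigma !mulr_sumr -!sumrN -!big_split /=.
apply: eq_bigr => c /andP[_ cn]; rewrite -(divn_mulz cn); ring.
Qed.

Lemma conv_3_3 : 120 * (3 ** 3) = sigma 7 n - sigma 3 n.
Proof.
unshelve epose proof (@divisor_convolution n
  (fun a b => a ^+ 2 * b ^+ 2 * (a - b) ^+ 2)
  (fun a b => 4 * (a ^+ 3 * b ^+ 3)) 30
  (fun c => c ^+ 7 - c ^+ 3) _ _ _ _) as E;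
  [move=> a b /=; ring|move=> a b /=; ring|move=> a b /=; ring|move=> c c0|].
  rewrite (sum_pos_ord (fun b => c%:Z ^+ 2 * b%:Z ^+ 2 * (c%:Z - b%:Z) ^+ 2)) // mulrBr.
  have P : forall m : nat,
      30 * \sum_(0 <= b < m) (c%:Z ^+ 2 * b%:Z ^+ 2 * (c%:Z - b%:Z) ^+ 2) =
    5 * c%:Z ^+ 4 * (m%:Z - 1) * m%:Z * (2 * m%:Z - 1)
    - 15 * c%:Z ^+ 3 * m%:Z ^+ 2 * (m%:Z - 1) ^+ 2
    + c%:Z ^+ 2 * (m%:Z - 1) * m%:Z * (2 * m%:Z - 1) * (3 * m%:Z ^+ 2 - 3 * m%:Z - 1).
    elim=> [|m IH]; first by rewrite big_geq //; ring.
    by rewrite big_nat_recr //= mulrDr IH intS; ring.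
  by rewrite P; ring.
move: E; rewrite /qsum -!mulr_sumr -/(qsum n xpredT (fun a b => a ^+ 3 * b ^+ 3)).
rewrite !qsum_conv => E.
transitivity (30 * (4 * (3 ** 3))); first ring.
rewrite E /sigma -!sumrN -!big_split /=.
apply: eq_bigr => c /andP[_ cn]; ring.
Qed.

Lemma conv_1_5 :
  504 * (1 ** 5) = sigma 1 n + 21 * sigma 5 n + 20 * sigma 7 n - 42 * n%:Z * sigma 5 n.
Proof.
unshelve epose proof (@divisor_convolution n
  (fun a b => a ^+ 6 + b ^+ 6 - 3 * (a ^+ 5 * b + a * b ^+ 5) + 5 * a ^+ 3 * b ^+ 3)
  (fun a b => 6 * (a ^+ 5 * b ^+ 1) + 6 * (a ^+ 1 * b ^+ 5) + - 10 * (a ^+ 3 * b ^+ 3)) 84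
  (fun c => 33 * c ^+ 7 - 84 * c ^+ 6 + 42 * c ^+ 5 + 7 * c ^+ 3 + 2 * c) _ _ _ _) as E;
  [move=> a b /=; ring|move=> a b /=; ring|move=> a b /=; ring|move=> c c0|].
  rewrite (sum_pos_ord (fun b => c%:Z ^+ 6 + b%:Z ^+ 6
    - 3 * (c%:Z ^+ 5 * b%:Z + c%:Z * b%:Z ^+ 5) + 5 * c%:Z ^+ 3 * b%:Z ^+ 3)) // mulrBr.
  have P : forall m : nat, 84 * \sum_(0 <= b < m) (c%:Z ^+ 6 + b%:Z ^+ 6
      - 3 * (c%:Z ^+ 5 * b%:Z + c%:Z * b%:Z ^+ 5) + 5 * c%:Z ^+ 3 * b%:Z ^+ 3) =
    84 * m%:Z * c%:Z ^+ 6
    + 2 * (m%:Z - 1) * m%:Z * (2 * m%:Z - 1) * (3 * m%:Z ^+ 4 - 6 * m%:Z ^+ 3 + 3 * m%:Z + 1)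
    - 126 * c%:Z ^+ 5 * m%:Z * (m%:Z - 1)
    - 21 * c%:Z * m%:Z ^+ 2 * (m%:Z - 1) ^+ 2 * (2 * m%:Z ^+ 2 - 2 * m%:Z - 1)
    + 105 * c%:Z ^+ 3 * m%:Z ^+ 2 * (m%:Z - 1) ^+ 2.
    elim=> [|m IH]; first by rewrite big_geq //; ring.
    by rewrite big_nat_recr //= mulrDr IH intS; ring.
  by rewrite P; ring.
move: E; rewrite /qsum !big_split /= -!mulr_sumr -/(qsum n xpredT (fun a b => a ^+ 5 * b ^+ 1)).
rewrite -/(qsum n xpredT (fun a b => a ^+ 1 * b ^+ 5)).
rewrite -/(qsum n xpredT (fun a b => a ^+ 3 * b ^+ 3)) !qsum_conv convC => E.
(* The identity E carries an extra -10 a^3 b^3. Since 84 * 12 = 2 * 504 and 84 * 10 = 7 * 120,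
   doubling the goal and adding 7 times [conv_3_3] removes it. *)
apply: (@mulfI _ 2) => //.
transitivity (84 * (6 * (1 ** 5) + 6 * (1 ** 5) + -10 * (3 ** 3)) + 7 * (120 * (3 ** 3))).
  ring.
rewrite E conv_3_3 /sigma !mulr_sumr -!sumrN -!big_split /= !mulr_sumr -!big_split /=.
apply: eq_bigr => c /andP[_ cn]; rewrite -(divn_mulz cn); ring.
Qed.

End Convolutions.

Section EulerProduct.
Variable R : comNzRingType.

Definition euler_part (N : nat) : series R := \prod_(m < N) (1 - qv ^+ m.+1).
Definition euler : series R := Series (fun n => cf (euler_part n) n).

Lemma euler_partS N : euler_part N.+1 = euler_part N * (1 - qv ^+ N.+1).
Proof. by rewrite /euler_part big_ord_recr. Qed.

Lemma cf_euler_part n N : (n <= N)%N -> cf (euler_part N) n = cf euler n.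
Proof.
elim: N => [|N IH]; first by rewrite leqn0 => /eqP ->.
rewrite leq_eqVlt => /orP[/eqP -> //|]; rewrite ltnS => nN.
rewrite euler_partS mulrBr mulr1 cfB IH //.
by rewrite mulrC cf_qvXM ltnS nN subr0.
Qed.

Lemma eqm_euler N : eqm N.+1 (euler_part N) euler.
Proof. by move=> n nN; apply: cf_euler_part. Qed.

Lemma cf_euler0 : cf euler 0 = 1.
Proof. by rewrite /= /euler_part big_ord0. Qed.

End EulerProduct.

Arguments euler_part {R}.
Arguments euler {R}.

Lemma smap_euler (R S : comNzRingType) (phi : {rmorphism R -> S}) :
  smap phi euler = euler.
Proof.
apply: series_ext => n /=; rewrite -cf_smap rmorph_prod; congr (cf _ n).
by apply: eq_bigr => i _; rewrite rmorphB rmorph1 rmorphXn /= smap_qv.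
Qed.

(** Derives an equation as a multiple of a known one; the cofactor [c] is supplied by hand and
    [ring] checks the rest. *)
Lemma eq_linear (R : comNzRingType) (c a b x y : R) :
  a = b -> x - y = c * (a - b) -> x = y.
Proof. by move=> ->; rewrite subrr mulr0 => /eqP; rewrite subr_eq0 => /eqP. Qed.

(** * Eisenstein series and Ramanujan's differential equations *)

Section Eisenstein.

Definition divsum (i : nat) : series int := Series (sigma i).

(** Logarithmic differentiation without division: [G m] is q^m / (1 - q^m), so theta (1 - q^m) = - m
    G_m (1 - q^m), and the sum of the m G_m is the series of sigma_1. *)
Lemma theta_euler : theta euler = - (euler * divsum 1).
Proof.
pose G (m : nat) : series int := Series (fun n => ((0 < n)%N && (m %| n)%N)%:R).
have Gq m : (0 < m)%N -> G m * (1 - qv ^+ m) = qv ^+ m.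
  move=> m0; rewrite mulrBr mulr1 mulrC; apply: series_ext => n.
  rewrite cfB cf_qvXM cf_qvX /=; case: (ltngtP n m) => [lt|lt|->].
  - by case: (posnP n) lt => [-> //|n0 lt]; rewrite gtnNdvd.
  - rewrite subn_gt0 lt (leq_ltn_trans _ lt) //= dvdn_subl ?subrr //.
    by rewrite ltnW.
  - by rewrite subnn m0 dvdnn.
have thE N : theta (euler_part N) =
    - (euler_part N * \sum_(m < N) (m.+1)%:R * G m.+1).
  elim: N => [|N IH]; first by rewrite /euler_part !big_ord0 mulr0 oppr0 theta1.
  rewrite euler_partS thetaM IH thetaB theta1 big_ord_recr /=.
  have -> : theta (qv ^+ N.+1) = N.+1%:R * qv ^+ N.+1 :> series int.
    by apply: series_ext => n; rewrite cf_natrM /= cf_qvX; case: eqP => [->|]; rewrite ?mulr0.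
  by rewrite -{2}(Gq N.+1) //; ring.
apply: eqm_all => N; apply: (@eqm_le _ N N.+1) => // n nN.
rewrite cf_theta -(eqm_euler _ nN) -cf_theta thE 2!cfN; congr (- _).
apply: (eqmM (N := N.+1) (@eqm_euler _ N)) nN => {n} n nN.
rewrite cf_sum; case: (posnP n) => [->|n0].
  by rewrite [RHS]sigma0 big1 // => m _; rewrite cf_natrM mulr0.
rewrite [RHS]/=.
rewrite (@sigma_widen 1 n N) ?n0 // [RHS]big_mkcond big_ord_recl [X in _ = X + _]/= add0r.
by apply: eq_bigr => m _; rewrite cf_natrM [cf _ _]/= n0 expr1 natz; case: ifP => _; rewrite ?mulr1 ?mulr0 ?natz.
Qed.

Lemma cf_divsumM i j n :
  cf (divsum i * divsum j) n = \sum_(k < n.+1) sigma i k * sigma j (n - k).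
Proof. by []. Qed.

Definition eisP : series int := 1 - 24 * divsum 1.
Definition eisQ : series int := 1 + 240 * divsum 3.
Definition eisR : series int := 1 - 504 * divsum 5.

Lemma euler_eisP : 24 * theta euler = euler * (eisP - 1).
Proof. by rewrite theta_euler /eisP; ring. Qed.

Lemma theta_eisP : 12 * theta eisP = eisP ^+ 2 - eisQ.
Proof.
have E : 12 * (divsum 1 * divsum 1) = 5 * divsum 3 + divsum 1 - 6 * theta (divsum 1).
  apply: series_ext => n; rewrite cfB cfD !cf_natrM cf_divsumM cf_theta /=.
  by rewrite conv_1_1 natz; ring.
apply: (eq_linear (c := - 48) E); rewrite /eisP /eisQ thetaB theta1 theta_natM; ring.
Qed.

Lemma theta_eisQ : 3 * theta eisQ = eisP * eisQ - eisR.
Proof.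
have E : 240 * (divsum 1 * divsum 3) = 21 * divsum 5 + 10 * divsum 3
    - divsum 1 - 30 * theta (divsum 3).
  apply: series_ext => n; rewrite !cfB cfD !cf_natrM cf_divsumM cf_theta /=.
  by rewrite conv_1_3 natz; ring.
apply: (eq_linear (c := 24) E); rewrite /eisP /eisQ /eisR thetaD theta1 theta_natM; ring.
Qed.

Lemma theta_eisR : 2 * theta eisR = eisP * eisR - eisQ ^+ 2.
Proof.
have E : 504 * (divsum 1 * divsum 5) = divsum 1 + 21 * divsum 5 + 20 * divsum 7
    - 42 * theta (divsum 5).
  apply: series_ext => n; rewrite !cfB !cfD !cf_natrM cf_divsumM cf_theta /=.
  by rewrite conv_1_5 natz; ring.
have E' : 120 * (divsum 3 * divsum 3) = divsum 7 - divsum 3.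
  by apply: series_ext => n; rewrite cfB cf_natrM cf_divsumM conv_3_3.
apply: (eq_linear (c := - 24) E); apply/eqP; rewrite eq_sym -subr_eq0; apply/eqP.
apply: (eq_linear (c := - 480) E').
rewrite /eisP /eisQ /eisR thetaB theta1 theta_natM; ring.
Qed.

End Eisenstein.

(** * Isobaric polynomials in Eisenstein series *)

Section Forms.
Variables (F : fieldType) (p q r : series F).

(* To avoid denominators in the derivations below, p, q, r stand for P/12, Q/144, R/432. *)
Inductive mform : nat -> series F -> Prop :=
| form0 w : mform w 0
| form1 : mform 0 1
| form_mulq w g : mform w g -> mform (w + 4) (q * g)
| form_mulr w g : mform w g -> mform (w + 6) (r * g)
| formD w f g : mform w f -> mform w g -> mform w (f + g)
| formZ w c g : mform w g -> mform w (sC c * g).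

Lemma form_eq w w' g g' : mform w g -> w = w' -> g = g' -> mform w' g'.
Proof. by move=> H <- <-. Qed.

Lemma form_natM w k g : mform w g -> mform w (k%:R * g).
Proof. by move=> fg; rewrite -(rmorph_nat (@sC F)); apply: formZ. Qed.

Lemma formN w g : mform w g -> mform w (- g).
Proof.
by move=> fg; apply: (form_eq (formZ (-1) fg)) => //; rewrite rmorphN1 mulN1r.
Qed.

Lemma formB w f g : mform w f -> mform w g -> mform w (f - g).
Proof. by move=> ff fg; apply: formD => //; apply: formN. Qed.

Lemma formM v w f g : mform v f -> mform w g -> mform (v + w) (f * g).
Proof.
move=> ff fg; elim: ff => {v f} [v||v f _ IH|v f _ IH|v f1 f2 _ IH1 _ IH2|v c f _ IH].
- by rewrite mul0r; apply: form0.
- by rewrite mul1r.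
- by apply: (form_eq (form_mulq IH)); [lia|rewrite mulrA].
- by apply: (form_eq (form_mulr IH)); [lia|rewrite mulrA].
- by rewrite mulrDl; apply: formD.
- by rewrite -mulrA; apply: formZ.
Qed.

Lemma form_q : mform 4 q.
Proof. by apply: (form_eq (form_mulq form1)); rewrite ?mulr1. Qed.
Lemma form_r : mform 6 r.
Proof. by apply: (form_eq (form_mulr form1)); rewrite ?mulr1. Qed.

Lemma formX w f k : mform w f -> mform (w * k) (f ^+ k).
Proof.
move=> ff; elim: k => [|k IH]; first by rewrite muln0; apply: form1.
by rewrite exprS mulnS; apply: formM.
Qed.

Definition disc : series F := 16 * q ^+ 3 - r ^+ 2.

Lemma form_disc : mform 12 disc.
Proof.
by apply: formB; [apply/form_natM; apply: (formX 3 form_q)|apply: (formX 2 form_r)].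
Qed.

(** ** Division by the discriminant and the vanishing criterion *)

Hypothesis disc0 : cf disc 0 = 0.
Hypothesis disc1 : cf disc 1 != 0.
Hypothesis q0 : cf q 0 != 0.
Hypothesis r0 : cf r 0 != 0.

Lemma disc_lreg : GRing.lreg disc.
Proof. by apply: (@lreg_order _ 1) => [[|i]|] //; apply/lregP. Qed.

(** The zero series is listed separately because the cofactor has weight w - 12, which is not a
    natural number for small w. *)
Definition disc_multiple w g :=
  g = 0 \/ exists v h, [/\ w = (v + 12)%N, mform v h & g = disc * h].

Lemma disc_multiple_lin w c f g :
  disc_multiple w f -> disc_multiple w g -> disc_multiple w (sC c * f + g).
Proof.
move=> [->|[v [h [-> fh ->]]]] [->|[v' [h' [e fh' ->]]]].
- by left; rewrite mulr0 addr0.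
- by right; exists v', h'; rewrite mulr0 add0r.
- right; exists v, (sC c * h); split=> //; [exact: formZ|ring].
- right; exists v, (sC c * h + h'); split=> //; last ring.
  apply: formD; first exact: formZ.
  by apply: (form_eq fh') => //; lia.
Qed.

Lemma disc_multipleM w v f g :
  mform v f -> disc_multiple w g -> disc_multiple (w + v) (f * g).
Proof.
move=> ff [->|[v' [h' [-> fh' ->]]]]; first by left; rewrite mulr0.
right; exists (v + v')%N, (f * h'); split; [lia|exact: formM|ring].
Qed.

(** One monomial per weight suffices modulo [disc], because r^2 = 16 q^3 - disc. It is 0 in odd
    weights and in weight 2, where no monomial exists. *)
Definition lead_form w : series F :=
  if (w %% 4 == 0)%N then q ^+ (w %/ 4)
  else if (w %% 4 == 2)%N && (6 <= w)%N then r * q ^+ ((w - 6) %/ 4) else 0.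

Lemma lead_form0 a : lead_form (4 * a) = q ^+ a.
Proof. by rewrite /lead_form modnMr mulKn. Qed.

Lemma lead_form2 a : lead_form (4 * a + 6) = r * q ^+ a.
Proof.
by rewrite /lead_form mulnC modnMDl addnK mulnK // leq_addl.
Qed.

Lemma lead_formP w :
  [\/ exists a, w = (4 * a)%N, exists a, w = (4 * a + 6)%N | lead_form w = 0].
Proof.
have [e|n0] := eqVneq (w %% 4)%N 0%N.
  by apply: Or31; exists (w %/ 4)%N; lia.
have [/andP[/eqP e le]|n2] := boolP ((w %% 4 == 2)%N && (6 <= w)%N).
  by apply: Or32; exists ((w - 6) %/ 4)%N; lia.
by apply: Or33; rewrite /lead_form (negPf n0) (negPf n2).
Qed.

Lemma lead_form_const w : lead_form w = 0 \/ cf (lead_form w) 0 != 0.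
Proof.
case: (lead_formP w) => [[a ->]|[a ->]|->]; [right|right|by left].
  by rewrite lead_form0 cfX0 expf_neq0.
by rewrite lead_form2 cfM0 cfX0 mulf_neq0 ?expf_neq0.
Qed.

Lemma form_lead w g : mform w g -> exists c, disc_multiple w (g - sC c * lead_form w).
Proof.
have s0 : sC (0 : F) = 0 by exact: rmorph0.
have z w' : disc_multiple w' 0 by left.
elim=> {w g} [w||w g _ [c IH]|w g _ [c IH]|w f g _ [c IHf] _ [c' IHg]|w c g _ [c' IH]].
- by exists 0; rewrite s0 mul0r subrr.
- by exists 1; rewrite (lead_form0 0) expr0 rmorph1 mulr1 subrr.
- have := disc_multipleM form_q IH.
  case: (lead_formP w) => [[a ea]|[a ea]|->] b.
  + exists c; have -> : (w + 4 = 4 * a.+1)%N by lia.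
    move: b; rewrite ea !lead_form0 exprS (_ : (4 * a + 4 = 4 * a.+1)%N); last lia.
    by rewrite mulrBr mulrCA.
  + exists c; move: b; rewrite ea lead_form2 (_ : (4 * a + 6 + 4 = 4 * a.+1 + 6)%N); last lia.
    by rewrite lead_form2 exprS mulrBr mulrCA [q * (r * _)]mulrCA.
  + by exists 0; rewrite s0 mul0r subr0; rewrite mulr0 subr0 in b.
- have := disc_multipleM form_r IH.
  case: (lead_formP w) => [[a ea]|[a ea]|->] b.
  + exists c; move: b; rewrite ea lead_form0 lead_form2.
    by rewrite mulrBr mulrCA.
  (* r * (r q^a) = 16 q^(a+3) - disc q^a. *)
  + exists (16 * c); rewrite ea lead_form2 in b; rewrite ea.
    have m : disc_multiple (4 * a + 6 + 6) (disc * q ^+ a).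
      right; exists (4 * a)%N, (q ^+ a); split=> //; [lia|exact: (formX a form_q)].
    have := disc_multiple_lin (- c) m b.
    have -> : (4 * a + 6 + 6 = 4 * a.+3)%N by lia.
    rewrite lead_form0 rmorphN rmorphM rmorph_nat.
    congr disc_multiple; rewrite !exprS /disc; ring.
  + by exists 0; rewrite s0 mul0r subr0; rewrite mulr0 subr0 in b.
- exists (c + c'); have := disc_multiple_lin 1 IHf IHg.
  by congr disc_multiple; rewrite rmorphD rmorph1; ring.
- exists (c * c'); have := disc_multiple_lin c IH (z w).
  by congr disc_multiple; rewrite rmorphM; ring.
Qed.

(** The leading monomial, if nonzero, has a nonzero constant term and [disc] has none, so the
    leading coefficient of g must be 0. *)
Lemma form_disc_multiple w g : mform w g -> cf g 0 = 0 -> disc_multiple w g.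
Proof.
move=> /form_lead[c dm] g0.
case: (lead_form_const w) => [l0|lw]; first by rewrite l0 mulr0 subr0 in dm.
have : cf (g - sC c * lead_form w) 0 = 0.
  by case: dm => [->|[v [h [_ _ ->]]]]; rewrite ?cf0 // cfM0 disc0 mul0r.
rewrite cfB g0 sub0r cf_sCM => /eqP; rewrite oppr_eq0 mulf_eq0 (negPf lw) orbF.
by move=> /eqP c0; move: dm; rewrite c0 rmorph0 mul0r subr0.
Qed.

(** Descent: dividing by [disc], of weight 12 and order 1, lowers the weight by 12 and uses up one
    coefficient. *)
Lemma form_sturm w g :
  mform w g -> (forall n, (12 * n <= w)%N -> cf g n = 0) -> g = 0.
Proof.
elim/ltn_ind: w g => w IH g fg g0.
case: (form_disc_multiple fg (g0 0%N isT)) => [//|[v [h [e fh gh]]]].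
rewrite gh (IH v _ h) ?mulr0 //; first by lia.
move=> n nv; rewrite -[RHS](cf0 _ n); apply: (@eqm_order _ 1 n.+1 disc) => //.
- by case.
- exact/lregP.
move=> m mn; rewrite -gh cf0; apply: g0; lia.
Qed.

End Forms.

(** * The derivation theta on forms, and its behaviour in characteristic l *)

Section Ramanujan.
Variables (F : fieldType) (p q r : series F).
Hypothesis theta_p : theta p = p ^+ 2 - q.
Hypothesis theta_q : theta q = 4 * p * q - r.
Hypothesis theta_r : theta r = 6 * p * r - 24 * q ^+ 2.
Local Notation mform := (mform q r).
Local Notation delta := (disc q r).

Lemma theta_disc : theta delta = 12 * p * delta.
Proof.
by rewrite /disc thetaB theta_natM !thetaX theta_q theta_r; ring.
Qed.

(** The Serre derivative: in theta q and theta r the coefficient of p is the weight, so subtracting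
    w p g removes p. *)
Lemma form_serre w g : mform w g -> mform (w + 2) (theta g - w%:R * p * g).
Proof.
elim=> {w g} [w||w g fg IH|w g fg IH|w f g _ IHf _ IHg|w c g _ IH].
- by rewrite raddf0 mulr0 subrr; apply: form0.
- by rewrite theta1 mul0r mul0r subrr; apply: form0.
- have a : mform (w + 4 + 2) (q * (theta g - w%:R * p * g)).
    by apply: (form_eq (form_mulq IH)) => //; lia.
  have b : mform (w + 4 + 2) (r * g).
    by apply: (form_eq (form_mulr fg)) => //; lia.
  by apply: (form_eq (formB a b)) => //; rewrite thetaM theta_q natrD; ring.
- have a : mform (w + 6 + 2) (r * (theta g - w%:R * p * g)).
    by apply: (form_eq (form_mulr IH)) => //; lia.
  have b : mform (w + 6 + 2) (24 * (q * (q * g))).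
    apply: form_natM; apply: (form_eq (form_mulq (form_mulq fg))) => //; lia.
  by apply: (form_eq (formB a b)) => //; rewrite thetaM theta_r natrD; ring.
- by apply: (form_eq (formD IHf IHg)) => //; rewrite thetaD; ring.
- by apply: (form_eq (formZ c IH)) => //; rewrite theta_sCM; ring.
Qed.

(* Cohen-Kuznetsov: (ck k f n).1 is the modular part of theta^n f for a form f of weight k;
   the second component only carries the previous term of the recursion. *)
Fixpoint ck (k : nat) (f : series F) (n : nat) : series F * series F :=
  if n is n'.+1 then
    let: (g, g') := ck k f n' in
    (theta g - (k + 2 * n')%:R * p * g - (n' * (n' + k).-1)%:R * q * g', g)
  else (f, 0).

(** The second conjunct includes the factor q because the initial second component would have weight
    k - 2, possibly negative. *)
Lemma form_ck k f n : mform k f ->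
  mform (k + 2 * n) (ck k f n).1 /\ mform (k + 2 * n.+1) (q * (ck k f n).2).
Proof.
move=> fk; elim: n => [|n]; first by rewrite /= mulr0 addn0; split=> //; apply: form0.
rewrite /=; case: (ck k f n) => g g' /= [fg fg']; split.
  apply: formB; first by apply: (form_eq (form_serre fg)) => //; lia.
  by rewrite -mulrA; apply: form_natM; apply: (form_eq fg').
by apply: (form_eq (form_mulq fg)) => //; lia.
Qed.

(** The binomial coefficient times (k + i)(k + i + 1)...(k + n - 1). *)
Definition ckc k n i := ('C(n, i) * (k + n).-1 ^_ (n - i))%N.

Lemma ckc_shift k n i : (i <= n)%N ->
  (ckc k n i.+1 * (i.+1 * (i + k)) = (n - i) * ckc k n i)%N.
Proof.
rewrite leq_eqVlt => /orP[/eqP ->|lt].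
  by rewrite /ckc bin_small // subnn.
rewrite /ckc; have -> : (n - i = (n - i.+1).+1)%N by lia.
rewrite ffactnSr (_ : ((k + n).-1 - (n - i.+1) = i + k)%N); last by lia.
have := mul_bin_left n i; have -> : (n - i = (n - i.+1).+1)%N by lia.
by move=> e; rewrite mulnACA [X in (X * _)%N]mulnC e; ring.
Qed.

Lemma ckc_rec0 k n : ckc k n.+1 0 = (ckc k n 0 * (n + k))%N.
Proof. by rewrite /ckc !bin0 !mul1n !subn0 addnS /= ffactnS mulnC addnC. Qed.

Lemma ckc_rec k n i : (i <= n)%N ->
  ckc k n.+1 i.+1 = (ckc k n i.+1 * (n + k + i.+1) + ckc k n i)%N.
Proof.
rewrite leq_eqVlt => /orP[/eqP ->|lt].
  by rewrite /ckc !binn (bin_small (ltnSn n)) !subnn.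
have := mul_bin_left n i.
rewrite /ckc binS subSS; have -> : (n - i = (n - i.+1).+1)%N by lia.
rewrite addnS [(k + n).+1.-1 ^_ _]ffactnS [(k + n).-1 ^_ _.+1]ffactnSr /=.
rewrite (_ : ((k + n).-1 - (n - i.+1) = i + k)%N); last by lia.
set c := 'C(n, i); set c' := 'C(n, i.+1); set t := _ ^_ _; set m := (n - i.+1)%N => e.
have -> : (n = m + i.+1)%N by rewrite /m subnK.
by have -> : ((c' + c) * ((k + (m + i.+1)) * t) =
  t * ((c' + c) * (k + i) + m.+1 * c' + m.+1 * c))%N; [ring|rewrite -e; ring].
Qed.

Lemma iter_theta_ck k f n :
  iter n theta f = \sum_(i < n.+1) (ckc k n i)%:R * p ^+ (n - i) * (ck k f i).1.
Proof.
elim: n => [|n IH].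
  by rewrite big_ord1 /ckc bin0 subnn ffactn0 muln1 expr0 !mul1r.
rewrite iterS IH raddf_sum /=.
(* Theta of the i-th summand: [v] keeps the index i, [w] moves to i + 1, and the terms with q come
   from the recursion of [ck] ([u i]) and from theta p = p^2 - q (by [ckc_shift], minus [u i.+1]),
   so they telescope. *)
pose u i := (ckc k n i * (i * (i + k).-1))%:R * p ^+ (n - i) * q * (ck k f i).2.
pose v i := (ckc k n i * (n + k + i))%:R * p ^+ (n.+1 - i) * (ck k f i).1.
pose w i := (ckc k n i)%:R * p ^+ (n - i) * (ck k f i.+1).1.
rewrite (eq_bigr (fun i : 'I_n.+1 => v i + w i + (u i - u i.+1))); last first.
  move=> i _; have le := ltn_ord i; rewrite /u /v /w /=.
  case: (ck k f i) => g g' /=.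
  have -> : theta ((ckc k n i)%:R * p ^+ (n - i) * g) = (ckc k n i)%:R *
      ((n - i)%:R * p ^+ (n - i).-1 * (p ^+ 2 - q) * g + p ^+ (n - i) * theta g).
    rewrite -mulrA theta_natM thetaM; congr (_ * (_ + _)); congr (_ * _).
    by case: (n - i)%N => [|m]; rewrite ?theta1 ?mul0r // thetaX theta_p.
  rewrite ckc_shift // subSn // subnS.
  move: (ckc k n i) (n - i)%N (subnKC (ltnSE le)) => c m en.
  have -> : (n + k + i = m + k + 2 * i)%N by lia.
  by case: m {en} => [|m]; rewrite /= !natrM !natrD ?natrM ?exprS /=; ring.
have u0 : \sum_(i < n.+1) (u i - u i.+1) = 0.
  rewrite -(big_mkord xpredT (fun i => u i - u i.+1)).
  under eq_bigr do rewrite -opprB.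
  rewrite sumrN telescope_sumr // /u mul0n muln0 /ckc bin_small //.
  by rewrite !mul0n !mul0r subrr oppr0.
have vn : v n.+1 = 0 by rewrite /v /ckc bin_small // !mul0n !mul0r.
rewrite big_split /= u0 addr0 big_split /=.
have -> : \sum_(i < n.+1) v i = \sum_(i < n.+2) v i.
  by rewrite [RHS]big_ord_recr /= vn addr0.
rewrite [X in X + _]big_ord_recl [RHS]big_ord_recl /= -addrA -big_split /=; congr (_ + _).
  by rewrite /v ckc_rec0 addn0 subn0.
apply: eq_bigr => i _; rewrite /v /w /bump /= !add1n ckc_rec ?natrD ?subSS; last first.
  by rewrite -ltnS.
by rewrite natrM natrD; ring.
Qed.

Variable l : nat.
Hypothesis l_gt4 : (4 < l)%N.
Hypothesis pcharF : l \in [pchar F].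

Let l_pr : prime l := pcharf_prime pcharF.

Lemma natr_pchar_series m : (l %| m)%N -> m%:R = 0 :> series F.
Proof.
move=> lm; rewrite -(rmorph_nat (@sC F)).
by move: lm; rewrite (dvdn_pcharf pcharF) => /eqP ->; rewrite rmorph0.
Qed.

Lemma iter_theta_pchar (f : series F) : iter l theta f = theta f.
Proof.
apply: series_ext => n; rewrite cf_iter_theta cf_theta; congr (_ * _).
exact: (pFrobenius_aut_nat pcharF).
Qed.

(** In the expansion of theta^l f the coefficient of index 0 < i < l contains the binomial
    coefficient of l over i, and that of index 0 is k(k + 1)...(k + l - 1), a product of l
    consecutive integers. Only i = l survives modulo l. *)
Lemma form_theta k f : mform k f -> mform (k + 2 * l) (theta f).
Proof.
move=> fk; rewrite -iter_theta_pchar (iter_theta_ck k) big_ord_recr /=.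
rewrite big1 => [|i _].
  rewrite add0r subnn /ckc binn subnn ffactn0 !mul1r.
  by case: (form_ck l fk).
rewrite natr_pchar_series ?mul0r // /ckc.
case: (posnP i) => [->|i0]; last by rewrite dvdn_mulr // prime_dvd_bin // i0 /=.
rewrite subn0 bin0 mul1n.
case: (posnP (k + l)) => [|kl]; first by have := prime_gt0 l_pr; lia.
have [lt|ge] := ltnP (k + l).-1 l; first by rewrite ffact_small.
by rewrite -bin_ffact dvdn_mull // dvdn_fact // prime_gt0 //=.
Qed.

Hypothesis disc0 : cf delta 0 = 0.
Hypothesis disc1 : cf delta 1 != 0.
Hypothesis q0 : cf q 0 != 0.
Hypothesis r0 : cf r 0 != 0.

Let reg := disc_lreg disc0 disc1.

Lemma small_unit m : (0 < m)%N -> (m < l)%N -> m%:R != 0 :> F.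
Proof. by move=> m0 ml; rewrite -(dvdn_pcharf pcharF) gtnNdvd. Qed.

Lemma form_divC w m f : m%:R != 0 :> F -> mform w (m%:R * f) -> mform w f.
Proof.
move=> m0 H; apply: (form_eq (formZ (m%:R^-1) H)) => //.
by rewrite mulrA -(rmorph_nat (@sC F)) -rmorphM mulVf // rmorph1 mul1r.
Qed.

Lemma form_disc_div w f : mform (w + 12) (delta * f) -> mform w f.
Proof.
move=> H; case: (form_disc_multiple disc0 disc1 q0 r0 H); first by rewrite cfM0 disc0 mul0r.
  by rewrite -[X in _ = X](mulr0 delta) => /reg ->; apply: form0.
by move=> [v [h [e fh /reg ->]]]; apply: (form_eq fh) => //; lia.
Qed.

(** 12 p = theta disc / disc, and theta disc is now a form of weight 12 + 2l. *)
Lemma form_p : mform (2 * l) p.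
Proof.
(* 12 may exceed l, but 3 and 4 are below l. *)
have u : (3 * 4)%:R != 0 :> F by rewrite natrM mulf_neq0 ?small_unit //; lia.
apply: (form_divC u); apply: form_disc_div.
by apply: (form_eq (form_theta (form_disc q r))); [lia|rewrite theta_disc; ring].
Qed.

(* In characteristic l the square of the Hasse invariant, of weight 2(l - 1), equals 1. *)
Lemma form_r_raise : mform (4 + 2 * l) r.
Proof.
apply: (@form_divC _ 3); first by rewrite small_unit //; lia.
apply: form_disc_div.
(* A bracket in which p cancels: q theta(disc) - 3 disc theta(q) = 3 disc r. *)
have a : mform (4 + 2 * l + 12) (q * theta delta).
  by apply: (form_eq (formM (form_q q r) (form_theta (form_disc q r)))) => //; lia.
have b : mform (4 + 2 * l + 12) (3 * (delta * theta q)).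
  apply: form_natM.
  by apply: (form_eq (formM (form_disc q r) (form_theta (form_q q r)))) => //; lia.
by apply: (form_eq (formB a b)) => //; rewrite theta_disc theta_q; ring.
Qed.

Section EtaPower.
Variables (e : series F) (d : nat).
Hypothesis theta_e : 24 * theta e = e * (12 * p - 1).
Hypothesis e0 : cf e 0 = 1.

(* e^d twist(f) = (24 theta + d) (e^d f) *)
Let twist f : series F := 24 * theta f + 12 * d%:R * p * f.

Lemma form_twist w f : mform w f -> mform (w + 2 * l) (twist f).
Proof.
move=> fw; apply: formD; first exact/form_natM/form_theta.
by apply: (form_eq (form_natM (12 * d) (formM fw form_p))) => //; rewrite natrM; ring.
Qed.

Lemma form_iter_twist j : mform (2 * l * j) (iter j twist 1).
Proof.
elim: j => [|j IH]; first by rewrite muln0; apply: form1.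
by rewrite iterS mulnS addnC; apply: form_twist.
Qed.

Lemma theta_eX : 24 * theta (e ^+ d) = d%:R * (e ^+ d) * (12 * p - 1).
Proof.
case: (d) => [|m]; first by rewrite theta1 mulr0 !mul0r.
rewrite thetaX exprS; transitivity (m.+1%:R * e ^+ m * (24 * theta e)); first ring.
by rewrite theta_e; ring.
Qed.

Lemma cf_twist j n :
  cf (e ^+ d * iter j twist 1) n = (24 * n + d)%:R ^+ j * cf (e ^+ d) n.
Proof.
elim: j n => [|j IH] n; first by rewrite mulr1 mul1r.
rewrite iterS; set g := iter j twist 1.
have -> : e ^+ d * twist g = 24 * theta (e ^+ d * g) + d%:R * (e ^+ d * g).
  rewrite thetaM /twist.
  transitivity (24 * theta (e ^+ d) * g + e ^+ d * (24 * theta g) + d%:R * e ^+ d * g);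
    last ring.
  by rewrite theta_eX; ring.
by rewrite cfD !cf_natrM cf_theta IH exprS natrD natrM; ring.
Qed.

(* Multiplying the n-th coefficient of e^d by (24n + d)^(l-1) amounts to replacing e^d by
   e^d g with g = twist^(l-1)(1); multiplication by r^l, which has both weights 6l and
   (4 + 2l)l, brings g and 1 to the same weight. *)
Theorem eta_power_vanish :
  (forall n, (12 * n <= (4 + 2 * l) * l)%N -> (l %| 24 * n + d)%N -> cf (e ^+ d) n = 0) ->
  forall n, (l %| 24 * n + d)%N -> cf (e ^+ d) n = 0.
Proof.
move=> small; set g := iter l.-1 twist 1; have l0 := prime_gt0 l_pr.
have cfg n : cf (e ^+ d * g) n = if (l %| 24 * n + d)%N then 0 else cf (e ^+ d) n.
  rewrite cf_twist; case: ifP => [|/negbT ln].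
    rewrite (dvdn_pcharf pcharF) => /eqP ->; rewrite expr0n.
    by rewrite (_ : _ == _ = false) ?mul0r //; lia.
  rewrite (_ : _ ^+ _ = 1) ?mul1r //.
  have nz : (24 * n + d)%:R != 0 :> F by rewrite -(dvdn_pcharf pcharF).
  apply: (mulfI nz); rewrite mulr1 -exprS prednK //.
  exact: (pFrobenius_aut_nat pcharF).
have rg : mform ((4 + 2 * l) * l) (r ^+ l * (g - 1)).
  rewrite mulrBr mulr1; apply: formB; last exact: formX form_r_raise.
  apply: (form_eq (formM (formX l (form_r q r)) (form_iter_twist l.-1))) => //.
  by rewrite -[in RHS](prednK l0); nia.
suff g1 : g = 1.
  by move=> n ln; have := cfg n; rewrite g1 mulr1 ln.
have rreg : GRing.lreg (r ^+ l).
  by apply: (@lreg_order _ 0) => //; rewrite cfX0; apply/lregP; rewrite expf_neq0.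
apply/eqP; rewrite -subr_eq0; apply/eqP/rreg; rewrite mulr0.
apply: (form_sturm disc0 disc1 q0 r0 rg) => n nw.
rewrite -(cf0 F n).
(* Where l does not divide 24i + d the two series agree by Fermat ([cfg]); the other indices are
   covered by the finite check. Cancelling e^d, with constant term 1, loses no precision. *)
have m : eqm n.+1 (e ^+ d * (g - 1)) (e ^+ d * 0).
  move=> i ni; rewrite mulr0 cf0 mulrBr mulr1 cfB cfg.
  by case: ifP => ln; rewrite ?subrr // small ?subrr //; lia.
have {}m : eqm n.+1 (g - 1) 0.
  by apply: (eqm_lreg _ m); rewrite cfX0 e0 expr1n; apply: lreg1.
by rewrite (eqmM (@eqm_refl _ n.+1 (r ^+ l)) m) ?mulr0.
Qed.

End EtaPower.

End Ramanujan.

(** * Specialization to P, Q, R and E modulo l *)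

Section EulerPowers.
Variable l : nat.
Hypothesis l_pr : prime l.
Hypothesis l_gt4 : (4 < l)%N.
Local Notation F := 'F_l.
Let pcharF : l \in [pchar F] := pchar_Fp l_pr.
Local Notation phi := (smap (intr : {rmorphism int -> F})).

Let n2 : 2 != 0 :> F.
Proof. by rewrite (small_unit pcharF) //; lia. Qed.
Let n3 : 3 != 0 :> F.
Proof. by rewrite (small_unit pcharF) //; lia. Qed.

Let n12 : 12 != 0 :> F.
Proof. by rewrite (_ : 12 = 2 ^+ 2 * 3) ?mulf_neq0 ?expf_neq0 //; ring. Qed.
Let n144 : 144 != 0 :> F.
Proof. by rewrite (_ : 144 = 2 ^+ 4 * 3 ^+ 2) ?mulf_neq0 ?expf_neq0 //; ring. Qed.
Let n432 : 432 != 0 :> F.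
Proof. by rewrite (_ : 432 = 2 ^+ 4 * 3 ^+ 3) ?mulf_neq0 ?expf_neq0 //; ring. Qed.

Let fp : series F := sC (12^-1) * phi eisP.
Let fq : series F := sC (144^-1) * phi eisQ.
Let fr : series F := sC (432^-1) * phi eisR.

Let c12 : sC 12^-1 * 12 = 1 :> series F.
Proof.
by rewrite -(rmorph_nat (@sC F)) -rmorphM mulVf ?rmorph1.
Qed.
Let c144 : sC 144^-1 = sC 12^-1 ^+ 2 :> series F.
Proof. by rewrite -rmorphXn exprVn; congr (sC _^-1); ring. Qed.
Let c432 : sC 432^-1 = 4 * sC 12^-1 ^+ 3 :> series F.
Proof.
rewrite -rmorphXn -(rmorph_nat (@sC F)) -rmorphM; congr sC.
by field; rewrite n12 n432.
Qed.

Let P := phi eisP.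
Let Q := phi eisQ.
Let R := phi eisR.

Let tP : 12 * theta P = P ^+ 2 - Q.
Proof. by rewrite -smap_theta -rmorphXn -rmorphB -theta_eisP rmorphM rmorph_nat. Qed.
Let tQ : 3 * theta Q = P * Q - R.
Proof. by rewrite -smap_theta -rmorphM -rmorphB -theta_eisQ rmorphM rmorph_nat. Qed.
Let tR : 2 * theta R = P * R - Q ^+ 2.
Proof. by rewrite -smap_theta -rmorphXn -rmorphM -rmorphB -theta_eisR rmorphM rmorph_nat. Qed.

Let cP n : cf (divsum n) 1 = 1.
Proof.
by rewrite /= /sigma big_mkcond /= !big_ord_recl big_ord0 /= expr1n addr0 add0r.
Qed.

Let c0Q : cf Q 0 = 1.
Proof. by rewrite cf_smap cfD cf_natrM cf1 [cf _ 0%N]sigma0 mulr0 addr0 rmorph1. Qed.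
Let c0R : cf R 0 = 1.
Proof. by rewrite cf_smap cfB cf_natrM cf1 [cf _ 0%N]sigma0 mulr0 subr0 rmorph1. Qed.
Let c1Q : cf Q 1 = 240.
Proof. by rewrite cf_smap cfD cf_natrM cf1 cP add0r mulr1 rmorph_nat. Qed.
Let c1R : cf R 1 = - 504.
Proof. by rewrite cf_smap cfB cf_natrM cf1 cP sub0r mulr1 rmorphN rmorph_nat. Qed.

Let discE : disc fq fr = sC (16 * 144^-1 ^+ 3) * Q ^+ 3 - sC (432^-1 ^+ 2) * R ^+ 2.
Proof.
rewrite /disc /fq /fr -/Q -/R; move: (144^-1) (432^-1) Q R => a b f g.
by rewrite rmorphM rmorph_nat !rmorphXn /= exprMn [(sC b * g) ^+ 2]exprMn mulrA.
Qed.

Let disc0 : cf (disc fq fr) 0 = 0.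
Proof.
rewrite discE cfB !cf_sCM !cfX0 c0Q c0R.
by field; rewrite ?n144 ?n432 ?n12.
Qed.

Let disc1 : cf (disc fq fr) 1 != 0.
Proof.
have cf1M (f g : series F) : cf (f * g) 1 = cf f 0 * cf g 1 + cf f 1 * cf g 0.
  by rewrite cfM !big_ord_recl big_ord0 addr0.
rewrite discE cfB !cf_sCM !exprS !expr0 !mulr1 !cf1M !cfM0 c0Q c0R c1Q c1R.
(* disc = (Q^3 - R^2) / 432^2 with Q^3 - R^2 = 1728 q + ..., and 1728 / 432^2 = 1/108. *)
rewrite (_ : _ - _ = (2 ^+ 2 * 3 ^+ 3)^-1) ?invr_neq0 ?mulf_neq0 ?expf_neq0 //.
have n108 : 108 != 0 :> F.
  by rewrite (_ : 108 = 2 ^+ 2 * 3 ^+ 3) ?mulf_neq0 ?expf_neq0 //; ring.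
by field; rewrite n108 n144 n432.
Qed.

Theorem euler_pow_dvd (d : nat) :
  (forall n, (12 * n <= (4 + 2 * l) * l)%N -> (l %| 24 * n + d)%N ->
     (l%:Z %| cf (euler ^+ d) n)%Z) ->
  forall n, (l %| 24 * n + d)%N -> (l%:Z %| cf (euler ^+ d) n)%Z.
Proof.
have E n : (l%:Z %| cf (euler ^+ d) n)%Z = (cf (euler ^+ d : series F) n == 0).
  by rewrite -(smap_euler (intr : {rmorphism int -> F})) -rmorphXn cf_smap /=
    (dvdz_pcharf pcharF).
move=> small n; rewrite E => ln; apply/eqP; move: n ln.
apply: (@eta_power_vanish F fp fq fr _ _ _ l l_gt4 pcharF).
- rewrite /fp /fq theta_sCM c144.
  transitivity (sC 12^-1 * (sC 12^-1 * 12) * theta P); first by rewrite c12 mulr1.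
  by rewrite -2!mulrA tP; ring.
- rewrite /fq /fp /fr theta_sCM c144 c432.
  transitivity (sC 12^-1 ^+ 2 * (sC 12^-1 * 12) * theta Q); first by rewrite c12 mulr1.
  by transitivity (4 * sC 12^-1 ^+ 3 * (3 * theta Q)); [|rewrite tQ]; ring.
- rewrite /fr /fp /fq theta_sCM c144 c432.
  transitivity (4 * sC 12^-1 ^+ 3 * (sC 12^-1 * 12) * theta R); first by rewrite c12 mulr1.
  by transitivity (24 * sC 12^-1 ^+ 4 * (2 * theta R)); [|rewrite tR]; ring.
- exact: disc0.
- exact: disc1.
- by rewrite cf_sCM c0Q mulr1 invr_neq0 // n144.
- by rewrite cf_sCM c0R mulr1 invr_neq0 // n432.
- rewrite /fp; transitivity (phi (24 * theta euler)).
    by rewrite rmorphM rmorph_nat /= smap_theta smap_euler.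
  rewrite euler_eisP rmorphM rmorphB rmorph1 /= smap_euler; congr (_ * (_ - _)).
  by rewrite mulrA [12 * _]mulrC c12 mul1r.
- exact: cf_euler0.
- by move=> n nb ln; apply/eqP; rewrite -E small.
Qed.

End EulerPowers.

(** * Euler's pentagonal number theorem *)

Definition tri s := (s.+1 * s)./2.

Arguments tri : simpl never.

Lemma tri_double s : (2 * tri s = s.+1 * s)%N.
Proof. by rewrite mul2n halfK oddM /= andNb subn0. Qed.

Lemma triS s : tri s.+1 = (tri s + s.+1)%N.
Proof. by have := tri_double s; have := tri_double s.+1; nia. Qed.

Section Pentagonal.
Variable R : comNzRingType.
Local Notation qv := (@qv R).

Let A (n s : nat) : series R := \prod_(s <= i < n) (1 - qv ^+ i.+1).

Definition pentagonal (n : nat) : series R :=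
  1 + \sum_(s < n) (-1) ^+ s.+1 *
    (qv ^+ (s.+1 * s + tri s.+1) + qv ^+ (s.+1 * s.+1 + tri s.+1)).

(* Shanks' finite form of the pentagonal number theorem *)
Lemma shanks n :
  \sum_(s < n.+1) (-1) ^+ s * A n s * qv ^+ (s * n + tri s) = pentagonal n.
Proof.
elim: n => [|n IH].
  by rewrite /pentagonal big_ord1 big_ord0 /A big_geq // !mul1r addr0.
rewrite /pentagonal [in RHS]big_ord_recr /= addrA -/(pentagonal n) -IH [in LHS]big_ord_recr /=.
rewrite {2}/A big_geq // mulr1 mulrDr addrA; congr (_ + _).
(* The difference between the sums for n + 1 and n is termwise g (s + 1) - g s, and g (n + 1) is one
   of the two new pentagonal terms; the other is the last summand. *)
pose g s : series R :=
  if s is s'.+1 then (-1) ^+ s * A n s' * qv ^+ (s * n + tri s) else 0.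
have -> : (-1) ^+ n.+1 * qv ^+ (n.+1 * n + tri n.+1) = g n.+1 - g 0%N.
  by rewrite /g subr0 /A big_geq // mulr1.
rewrite -telescope_sumr // big_mkord -big_split /=; apply: eq_bigr => s _.
have sn : (s <= n)%N by rewrite -ltnS.
have -> : A n.+1 s = A n s * (1 - qv ^+ n.+1) by rewrite /A big_nat_recr.
have -> : g s = (-1) ^+ s * (1 - qv ^+ s) * A n s * qv ^+ (s * n + tri s).
  case: (nat_of_ord s) sn => [|s'] sn; first by rewrite expr0 subrr mulr0 !mul0r.
  by rewrite /g; congr (_ * _); rewrite -mulrA; congr (_ * _); rewrite /A big_ltn.
rewrite /g triS !mulnS !mulSn !exprD ![_ ^+ _.+1]exprS.
move: ((-1) ^+ s) (A n s) (qv ^+ s) (qv ^+ n) (qv ^+ (s * n)) (qv ^+ tri s) => *; ring.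
Qed.

Theorem euler_pentagonal n : eqm n.+1 euler (pentagonal n).
Proof.
apply: eqm_trans (eqm_sym (@eqm_euler R n)) _; rewrite -shanks big_ord_recl.
rewrite mul0n expr0 mulr1 mul1r /A big_mkord -/(euler_part n).
rewrite -[X in eqm _ X]addr0; apply: eqmD => // m mn.
rewrite cf0 cf_sum big1 // => s _; rewrite mulrC cf_qvXM lift0.
by rewrite (leq_trans mn) // triS; nia.
Qed.

Lemma cf_euler_square m : cf (euler : series R) m != 0 -> exists a, (24 * m + 1 = a ^ 2)%N.
Proof.
rewrite (@euler_pentagonal m) // /pentagonal cfD cf1 cf_sum.
case: (posnP m) => [->|m0]; first by exists 1%N.
rewrite mulr0n add0r => nz.
have [s] : exists s : 'I_m,
    (m == s.+1 * s + tri s.+1)%N || (m == s.+1 * s.+1 + tri s.+1)%N.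
  apply/existsP; apply: contraNT nz => /existsPn no; apply/eqP; apply: big1 => s _.
  have := no s; rewrite negb_or => /andP[n1 n2].
  have -> : (-1) ^+ s.+1 = sC ((-1) ^+ s.+1) :> series R by rewrite rmorphXn rmorphN1.
  by rewrite cf_sCM cfD !cf_qvX (negPf n1) (negPf n2) addr0 mulr0.
(* With j = s + 1 the exponents are j(3j - 1)/2 and j(3j + 1)/2, for which 24m + 1 is (6j - 1)^2 and
   (6j + 1)^2. *)
have t := tri_double s.+1; case/orP => /eqP e.
  by exists (6 * s + 5)%N; rewrite -mulnn; nia.
by exists (6 * s + 7)%N; rewrite -mulnn; nia.
Qed.

End Pentagonal.

Lemma eqm_sum_tail (R : comNzRingType) K n N (F : nat -> series R) : (n <= N)%N ->
  (forall j, (n <= j)%N -> eqm K (F j) 0) ->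
  eqm K (\sum_(j < N) F j) (\sum_(j < n) F j).
Proof.
move=> nN F0; rewrite -!(big_mkord xpredT F) (big_cat_nat (leq0n n) nN) /=.
rewrite -[X in eqm _ _ X]addr0; apply: eqmD => // m mK.
by rewrite cf0 cf_sum big_nat big1 // => j /andP[nj _]; rewrite F0 ?cf0.
Qed.

Lemma bin2_double m : (2 * 'C(m, 2) + m = m * m)%N.
Proof. by rewrite -mul_bin_diag bin1; case: m => // m; rewrite /= addnC -mulnS. Qed.

(** With n = m + j, this and the next lemma show that the terms k = n - j and k = n + 1 + j of the
    derived q-binomial sum carry the same power of q. *)
Lemma jacobi_exp1 m j :
  ('C(m, 2) + (m + j) * ((m + j).*2.+1 - m) =
   (m + j) + 'C(m + j, 2) + (m + j) * (m + j) + tri j)%N.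
Proof.
rewrite (_ : ((m + j).*2.+1 - m = m + 2 * j + 1)%N); last by lia.
by have := bin2_double m; have := bin2_double (m + j); have := tri_double j; nia.
Qed.

Lemma jacobi_exp2 m j :
  ('C((m + j).+1 + j, 2) + (m + j) * ((m + j).*2.+1 - ((m + j).+1 + j)) =
   (m + j) + 'C(m + j, 2) + (m + j) * (m + j) + tri j)%N.
Proof.
rewrite (_ : ((m + j).*2.+1 - ((m + j).+1 + j) = m)%N); last by lia.
have := bin2_double ((m + j).+1 + j); have := bin2_double (m + j).
by have := tri_double j; nia.
Qed.

(** * Jacobi's identity for the cube, from the q-binomial theorem *)

Section Jacobi.
Variable R : comNzRingType.
Local Notation qv := (@qv R).
Local Notation poch := (@euler_part R).

(** Gaussian binomial coefficients through the q-Pascal rule, which avoids dividing series. *)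
Fixpoint qbin (N k : nat) : series R :=
  match N, k with
  | _, 0%N => 1
  | 0%N, _ => 0
  | N'.+1, k'.+1 => qbin N' k + qv ^+ (N' - k') * qbin N' k'
  end.

Arguments qbin : simpl never.

Lemma qbin0 N : qbin N 0 = 1. Proof. by case: N. Qed.
Lemma qbinS N k : qbin N.+1 k.+1 = qbin N k.+1 + qv ^+ (N - k) * qbin N k.
Proof. by []. Qed.

Lemma qbin_small N k : (N < k)%N -> qbin N k = 0.
Proof.
elim: N k => [|N IH] [|k] // Nk; rewrite qbinS !IH ?mulr0 ?addr0 //.
exact: ltnW.
Qed.

Lemma qbin_poch k m : qbin (k + m) k * poch k * poch m = poch (k + m).
Proof.
move eN : (k + m)%N => N; elim: N k m eN => [|N IH] [|k] [|m] // eN.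
- by rewrite /euler_part big_ord0 !mulr1.
- by rewrite -eN qbin0 /euler_part big_ord0 !mul1r.
- have kN : k = N by move: eN; rewrite addn0 => -[].
  have E := IH N 0%N (addn0 N); rewrite kN qbinS (qbin_small (ltnSn N)) subnn expr0 add0r mul1r.
  by rewrite euler_partS -[in RHS]E; ring.
have e1 : (k.+1 + m = N)%N by lia.
have e2 : (k + m.+1 = N)%N by lia.
have := IH _ _ e2; have := IH _ _ e1; rewrite qbinS !euler_partS => E1 E2.
have -> : (N - k = m.+1)%N by lia.
have -> : qv ^+ N.+1 = qv ^+ m.+1 * qv ^+ k.+1 by rewrite -exprD; congr (_ ^+ _); lia.
transitivity
  (qbin N k.+1 * (poch k * (1 - qv ^+ k.+1)) * poch m * (1 - qv ^+ m.+1)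
   + qv ^+ m.+1 * (1 - qv ^+ k.+1)
     * (qbin N k * poch k * (poch m * (1 - qv ^+ m.+1)))); first ring.
by rewrite E1 E2; ring.
Qed.

Lemma poch_lreg N : GRing.lreg (poch N).
Proof. by apply: lreg_const1; rewrite cf_euler_part ?cf_euler0. Qed.

Lemma qbin_sym k m : qbin (k + m) m = qbin (k + m) k.
Proof.
apply: (@lregM _ (poch k) (poch m)); [exact: poch_lreg..|].
have := qbin_poch m k; rewrite [(m + k)%N]addnC -[in RHS]qbin_poch => e.
rewrite [RHS](_ : _ = qbin (k + m) k * poch k * poch m); last ring.
by rewrite -e; ring.
Qed.

(** The polynomial variable allows a formal derivative; y will be q^n, which centres the product
    without negative powers of q. *)
Lemma qbin_theorem N (y : series R) :
  \prod_(i < N) (y%:P - (qv ^+ i) *: 'X) =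
  \sum_(k < N.+1) ((-1) ^+ k * qbin N k * qv ^+ 'C(k, 2) * y ^+ (N - k)) *: 'X^k.
Proof.
elim: N => [|N IH].
  by rewrite big_ord0 big_ord1 /= bin0n expr0 !mul1r scale1r.
pose c N k : series R := (-1) ^+ k * qbin N k * qv ^+ 'C(k, 2) * y ^+ (N - k).
rewrite big_ord_recr IH -/(c N) /= mulrBr.
have -> : (\sum_(k < N.+1) c N k *: 'X^k) * y%:P =
    \sum_(k < N.+2) (c N k * y) *: 'X^k :> {poly series R}.
  rewrite [RHS]big_ord_recr /= [c N N.+1]/c (qbin_small (ltnSn N)) mulr0 !mul0r scale0r addr0.
  by rewrite mulr_suml; apply: eq_bigr => k _; rewrite mulrC mul_polyC scalerA mulrC.
have -> : (\sum_(k < N.+1) c N k *: 'X^k) * (qv ^+ N *: 'X) =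
    \sum_(k < N.+1) (c N k * qv ^+ N) *: 'X^(k.+1) :> {poly series R}.
  rewrite mulr_suml; apply: eq_bigr => k _.
  by rewrite -scalerAl -scalerAr scalerA -exprSr.
rewrite [RHS]big_ord_recl [X in X - _]big_ord_recl -addrA; congr (_ + _).
  by rewrite /c /= !qbin0 !subn0 exprSr !mulrA.
rewrite -sumrB; apply: eq_bigr => k _; rewrite -scalerBl lift0; congr (_ *: _).
have kN : (k <= N)%N by rewrite -ltnS.
have eN : qv ^+ 'C(k, 2) * qv ^+ N = qv ^+ 'C(k.+1, 2) * qv ^+ (N - k).
  by rewrite -!exprD binS bin1; congr (_ ^+ _); lia.
rewrite /c subSS qbinS exprS.
transitivity (- ((-1) ^+ k * qbin N k.+1 * qv ^+ 'C(k.+1, 2) * (y ^+ (N - k.+1) * y))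
  - (-1) ^+ k * qbin N k * (qv ^+ 'C(k, 2) * qv ^+ N) * y ^+ (N - k)); first ring.
rewrite eN; have [lt|ge] := ltnP k N.
  by rewrite -exprSr (_ : ((N - k.+1).+1 = N - k)%N); [ring|lia].
by rewrite qbin_small ?ltnS //; ring.
Qed.

Lemma prod_around (V : comPzSemiRingType) (f : nat -> V) n :
  \prod_(i < n.*2.+1) f i = \prod_(i < n) f i * f n * \prod_(j < n) f (n.+1 + j)%N.
Proof.
rewrite -(big_mkord xpredT f) (@big_cat_nat _ _ _ n) //=; last by lia.
rewrite [\prod_(n <= _ < _) _]big_ltn; last by lia.
rewrite mulrA big_mkord; congr (_ * _).
rewrite -[X in \big[_/_]_(X <= _ < _) _]add0n big_addn big_mkord.
rewrite (_ : (n.*2.+1 - n.+1 = n)%N); last by lia.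
by apply: eq_bigr => j _; rewrite addnC.
Qed.

(* derivative at 1 of the q-binomial theorem for N = 2n + 1 and y = q^n *)
Lemma jacobi_deriv n :
  let D := (n + 'C(n, 2) + n * n)%N in
  - ((-1) ^+ n * qv ^+ D * poch n ^+ 2) =
  \sum_(k < n.*2.+2) k%:R * ((-1) ^+ k * qbin n.*2.+1 k *
    qv ^+ ('C(k, 2) + n * (n.*2.+1 - k))).
Proof.
move=> D; have := congr1 (fun P => P^`().[1]) (qbin_theorem n.*2.+1 (qv ^+ n)).
rewrite raddf_sum horner_sum => /= E.
rewrite [RHS](eq_bigr (fun k : 'I_n.*2.+2 => (((-1) ^+ k * qbin n.*2.+1 k * qv ^+ 'C(k, 2) *
  (qv ^+ n) ^+ (n.*2.+1 - k)) *: 'X^k)^`().[1])); last first.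
  move=> k _; rewrite derivZ derivXn hornerZ hornerMn hornerXn expr1n -exprM exprD.
  by rewrite -[1 *+ k]/(k%:R); ring.
pose f i : {poly series R} := (qv ^+ n)%:P - qv ^+ i *: 'X.
rewrite -E (prod_around f); have fE i : (f i).[1] = qv ^+ n - qv ^+ i by rewrite /f !hornerE.
(* The factor i = n vanishes at 1, so only the term in which it is differentiated survives. *)
rewrite derivM hornerD !hornerM fE subrr mulr0 mul0r addr0 derivM hornerD !hornerM fE.
rewrite subrr mulr0 add0r !horner_prod derivB derivC derivZ derivX !hornerE.
have -> : \prod_(i < n) (f i).[1] = (-1) ^+ n * qv ^+ 'C(n, 2) * poch n.
  rewrite /D /euler_part [X in _ * X](reindex_inj rev_ord_inj) /=.
  have -> : (-1) ^+ n * qv ^+ 'C(n, 2) = \prod_(i < n) (- qv ^+ i) :> series R.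
    rewrite prodrN cardT size_enum_ord; congr (_ * _).
    by rewrite prodrXr; congr (_ ^+ _); rewrite -bin2_sum big_mkord.
  rewrite -big_split; apply: eq_bigr => i _; rewrite fE /= mulrBr mulr1.
  rewrite mulNr opprK -exprD [RHS]addrC; congr (_ ^+ _ - _).
  by have := ltn_ord i; lia.
have -> : \prod_(j < n) (f (n.+1 + j)%N).[1] = qv ^+ (n * n) * poch n.
  rewrite /euler_part exprM -[X in _ ^+ X]card_ord -prodr_const -big_split.
  by apply: eq_bigr => i _; rewrite fE /= mulrBr mulr1 -exprD; congr (_ - _ ^+ _); lia.
by rewrite /D !exprD /=; ring.
Qed.

(** The terms k = n - j and k = n + 1 + j of [jacobi_deriv] have equal Gaussian binomials, equal
    powers of q and opposite signs, so the factors k combine to 2j + 1. The common power q^D is then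
    cancelled. *)
Lemma jacobi_finite n :
  poch n ^+ 2 = \sum_(j < n.+1) (-1) ^+ j * j.*2.+1%:R * qv ^+ tri j * qbin n.*2.+1 (n - j).
Proof.
pose D := (n + 'C(n, 2) + n * n)%N.
suff : (-1) ^+ n * qv ^+ D * poch n ^+ 2 = (-1) ^+ n * qv ^+ D *
    \sum_(j < n.+1) (-1) ^+ j * j.*2.+1%:R * qv ^+ tri j * qbin n.*2.+1 (n - j).
  move: (poch n ^+ 2) (\sum_(_ < _) _) => X Y.
  rewrite -mulrA -[RHS]mulrA => /(congr1 (fun x => (-1) ^+ n * x)).
  rewrite !mulrA -exprMn mulrN1 opprK expr1n !mul1r.
  have reg : GRing.lreg (qv ^+ D).
    apply: (@lreg_order _ D) => [i iD|]; rewrite cf_qvX ?eqxx ?(ltn_eqF iD) //.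
    exact: lreg1.
  exact: reg.
rewrite -[LHS]opprK jacobi_deriv mulr_sumr -addnn -addnS -addSn big_split_ord /=.
rewrite [X in X + _](reindex_inj rev_ord_inj) -big_split -sumrN /=.
apply: eq_bigr => j _; have jn : (j <= n)%N by rewrite -ltnS.
rewrite subSS addnS addnn.
have -> : qbin n.*2.+1 (n.+1 + j) = qbin n.*2.+1 (n - j).
  by have := qbin_sym (n - j) (n.+1 + j); rewrite (_ : (n - j + (n.+1 + j) = n.*2.+1)%N); [|lia].
have nj : (n - j + j = n)%N by rewrite subnK.
have e1 : ('C(n - j, 2) + n * (n.*2.+1 - (n - j)) = D + tri j)%N.
  by have := jacobi_exp1 (n - j) j; rewrite nj.
have e2 : ('C(n.+1 + j, 2) + n * (n.*2.+1 - (n.+1 + j)) = D + tri j)%N.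
  by have := jacobi_exp2 (n - j) j; rewrite nj.
have s1 : (-1) ^+ n = (-1) ^+ (n - j) * (-1) ^+ j :> series R.
  by rewrite -exprD subnK.
rewrite e1 e2 exprD s1.
have -> : (-1) ^+ (n.+1 + j) = - (-1) ^+ (n - j) :> series R.
  rewrite (_ : (n.+1 + j = (n - j) + 1 + 2 * j)%N); last by lia.
  by rewrite exprD exprD expr1 exprM sqrrN expr1n expr1n; ring.
have -> : (-1) ^+ (n - j) * (-1) ^+ j * qv ^+ D * ((-1) ^+ j * j.*2.+1%:R * qv ^+ tri j
    * qbin n.*2.+1 (n - j)) = ((-1) ^+ j) ^+ 2 * (-1) ^+ (n - j) * qv ^+ D
    * j.*2.+1%:R * qv ^+ tri j * qbin n.*2.+1 (n - j) by ring.
rewrite -exprM [(j * 2)%N]mulnC exprM sqrrN expr1n expr1n.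
have -> : j.*2.+1%:R = (n.+1 + j)%:R - (n - j)%:R :> series R.
  by rewrite -natrB; [congr (_%:R); lia|lia].
ring.
Qed.

(** The finite identity is used at 2n: for j < n each of the three Euler products in the Gaussian
    binomial then has at least n factors, so it agrees with E modulo q^n, and E times the binomial
    is 1. For j >= n the power q^(tri j) vanishes modulo q^n. *)
Theorem euler_cube n :
  eqm n (euler ^+ 3) (\sum_(j < n) (-1) ^+ j * j.*2.+1%:R * qv ^+ tri j).
Proof.
have E N m : (N <= m.+1)%N -> eqm N (poch m) euler.
  by move=> Nm; apply: eqm_le Nm _; apply: eqm_euler.
have := jacobi_finite n.*2.
have big j : (j < n.*2.+1)%N ->
  eqm n (qv ^+ tri j * (euler * qbin n.*2.*2.+1 (n.*2 - j))) (qv ^+ tri j).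
  move=> jn; have [lt|ge] := ltnP j n; last first.
    have tj : (n <= tri j)%N by have := tri_double j; nia.
    by apply: eqm_trans (eqm_qvX _ tj) _; rewrite -[qv ^+ _]mulr1; apply/eqm_sym/eqm_qvX.
  rewrite -[X in eqm n _ X]mulr1; apply: eqmM => //.
  have := qbin_poch (n.*2 - j) (n.*2.+1 + j).
  rewrite (_ : (n.*2 - j + (n.*2.+1 + j) = n.*2.*2.+1)%N); last by lia.
  set b := qbin _ _ => e.
  apply: (@eqm_lreg _ _ euler); first by rewrite cf_euler0; apply: lreg1.
  apply: (@eqm_trans _ _ (b * poch (n.*2 - j) * poch (n.*2.+1 + j))).
    rewrite (_ : euler * (euler * b) = b * euler * euler); last by ring.
    by apply: eqmM; [apply: eqmM => //|]; apply/eqm_sym/E; lia.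
  by rewrite e mulr1; apply: E; lia.
move=> J; apply: (@eqm_trans _ _ (euler * poch n.*2 ^+ 2)).
  by rewrite exprS; apply: eqmM => //; apply/eqmX/eqm_sym/E; lia.
rewrite J mulr_sumr.
apply: (@eqm_trans _ _ (\sum_(j < n.*2.+1) (-1) ^+ j * j.*2.+1%:R * qv ^+ tri j)).
  apply: eqm_sum => j _.
  rewrite [X in eqm _ X](_ : _ = (-1) ^+ j * j.*2.+1%:R *
    (qv ^+ tri j * (euler * qbin n.*2.*2.+1 (n.*2 - j)))); last by ring.
  by apply: eqmM => //; apply: big.
apply: (eqm_sum_tail (F := fun j => (-1) ^+ j * j.*2.+1%:R * qv ^+ tri j)); first by lia.
by move=> j nj; rewrite mulrC; apply: eqm_qvX; have := tri_double j; nia.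
Qed.

Lemma tri_inj : injective tri.
Proof. by move=> i j; have := tri_double i; have := tri_double j; nia. Qed.

Lemma cf_euler_cube m :
  cf (euler ^+ 3 : series R) m = 0 \/
  exists j, m = tri j /\ cf (euler ^+ 3 : series R) m = (-1) ^+ j * j.*2.+1%:R.
Proof.
have cfE j : cf ((-1) ^+ j * j.*2.+1%:R * qv ^+ tri j) m =
    (-1) ^+ j * j.*2.+1%:R *+ (m == tri j) :> R.
  have -> : (-1) ^+ j = sC ((-1) ^+ j) :> series R by rewrite rmorphXn rmorphN1.
  by rewrite -mulrA cf_sCM cf_natrM cf_qvX mulr_natr mulrnAr.
rewrite (@euler_cube m.+1) // cf_sum.
case: (pickP (fun j : 'I_m.+1 => m == tri j)) => [j mj|no]; [right|left].
  exists j; split; first exact/eqP.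
  rewrite (bigD1 j) // cfE mj mulr1n big1 => [|i ij]; first exact: addr0.
  rewrite cfE; case: eqP => // mi; case/eqP: ij; apply: val_inj; apply: tri_inj.
  by rewrite -mi; apply/eqP.
by apply: big1 => j _; rewrite cfE no.
Qed.

End Jacobi.

Module Z := BinInt.Z.
Local Notation Z := BinNums.Z.

(** * Truncated computation of powers of the Euler product *)

(* acc + c q^e f, truncated to the length of acc *)
Fixpoint axpy (c : Z) (e : nat) (f acc : seq Z) : seq Z :=
  match acc, e with
  | [::], _ => [::]
  | a :: acc', e'.+1 => a :: axpy c e' f acc'
  | a :: acc', 0%N => if f is x :: f' then Z.add a (Z.mul c x) :: axpy c 0 f' acc' else acc
  end.

Definition sparse_mul (sp : seq (nat * Z)) (f : seq Z) : seq Z :=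
  foldr (fun ec acc => axpy ec.2 ec.1 f acc) (nseq (size f) Z.zero) sp.

Definition reduce (l : Z) (f : seq Z) : seq Z := [seq Z.modulo x l | x <- f].

Definition cube_terms (n : nat) : seq (nat * Z) :=
  [seq (tri j, if odd j then Z.opp (Z.of_nat j.*2.+1) else Z.of_nat j.*2.+1) | j <- iota 0 n].

Definition euler_terms (n : nat) : seq (nat * Z) :=
  (0%N, Z.one) :: flatten [seq
    [:: ((s.+1 * s + tri s.+1)%N, if odd s then Z.one else Z.opp Z.one);
        ((s.+1 * s.+1 + tri s.+1)%N, if odd s then Z.one else Z.opp Z.one)] | s <- iota 0 n].

Fixpoint dot (f g : seq Z) : Z :=
  match f, g with x :: f', y :: g' => Z.add (Z.mul x y) (dot f' g') | _, _ => Z.zero end.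

Definition square_coef (f : seq Z) (n : nat) : Z :=
  dot (take n.+1 f) (rev (take n.+1 f)).

Definition half_power (l : Z) (u v n3 n1 N : nat) : seq Z :=
  iter v (fun f => reduce l (sparse_mul (euler_terms n1) f))
    (iter u (fun f => reduce l (sparse_mul (cube_terms n3) f)) (Z.one :: nseq N Z.zero)).

Definition check_square (l : Z) (L : seq Z) (ns : seq nat) : bool :=
  all (fun n => Z.eqb (Z.modulo (square_coef L n) l) Z.zero) ns.

(* Checks, for d = 2(3u + v), the coefficients of q^r, q^(r+l), ..., q^(r+kl) in the d-th power
   of the Euler product, computed as the square of its (3u+v)-th power; n3 and n1 are numbers of
   terms of Jacobi's and Euler's series that suffice for this precision. *)
Definition check_case (l u v n3 n1 r k : nat) : bool :=
  let d := (2 * (3 * u + v))%N in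
  let N := (r + l * k)%N in
  [&& prime l, (4 < l)%N, (r < l)%N, (l %| 24 * r + d)%N,
      ((4 + 2 * l) * l < 12 * (r + l * k.+1))%N, (N < tri n3)%N,
      (N < n1.+1 * n1 + tri n1.+1)%N
    & check_square (Z.of_nat l) (half_power (Z.of_nat l) u v n3 n1 N)
        [seq (r + l * i)%N | i <- iota 0 k.+1]].

Lemma size_axpy c e f acc : size (axpy c e f acc) = size acc.
Proof.
by elim: acc e f => [|a acc IH] [|e] [|x f] //=; rewrite IH.
Qed.

Lemma nth_axpy c e f acc i : (i < size acc)%N ->
  nth 0 (axpy c e f acc) i =
  nth 0 acc i + (if (e <= i)%N then c * nth 0 f (i - e) else 0).
Proof.
elim: acc e f i => [|a acc IH] [|e] [|x f] [|i] //= ia; rewrite ?addr0 ?mulr0 ?addr0 //.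
- by rewrite IH // subn0.
- by rewrite IH // ltnS subSS.
- by rewrite IH // ltnS subSS.
Qed.

Lemma size_sparse_mul sp f : size (sparse_mul sp f) = size f.
Proof. by elim: sp => [|ec sp IH]; rewrite /= ?size_nseq // size_axpy. Qed.

Lemma dotE f g : size f = size g ->
  dot f g = \sum_(i < size f) nth 0 f i * nth 0 g i.
Proof.
elim: f g => [|x f IH] [|y g] //=; first by rewrite big_ord0.
by move=> [e]; rewrite big_ord_recl IH.
Qed.

Lemma square_coefE f n : (n < size f)%N ->
  square_coef f n = \sum_(i < n.+1) nth 0 f i * nth 0 f (n - i).
Proof.
move=> nf; rewrite /square_coef dotE ?size_rev // size_takel //.
apply: eq_bigr => i _; rewrite nth_take // nth_rev ?size_takel // nth_take ?subSS //.
by rewrite ltnS leq_subr.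
Qed.

Lemma Z_of_natE k : Z.of_nat k = k%:R.
Proof. by rewrite -[k in LHS]natn rmorph_nat. Qed.

Section Correctness.
Variables (R : comNzRingType) (psi : {rmorphism Z -> R}).
Implicit Types (s t : series R) (L : seq Z).

Definition agree L s := forall i, (i < size L)%N -> cf s i = psi (nth 0 L i).

Lemma agree_eqm L s t : eqm (size L) s t -> agree L s -> agree L t.
Proof. by move=> st Ls i iL; rewrite -st // Ls. Qed.

Lemma agree_axpy c e f acc s t : size acc = size f -> agree f s -> agree acc t ->
  agree (axpy c e f acc) (t + sC (psi c) * (qv ^+ e * s)).
Proof.
move=> sz fs at' i; rewrite size_axpy => ia.
rewrite nth_axpy // rmorphD -at' // cfD cf_sCM cf_qvXM ltnNge.
case: leqP => ei /=; last by rewrite rmorph0 mulr0.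
by rewrite rmorphM -fs // -sz (leq_ltn_trans (leq_subr _ _)).
Qed.

Lemma agree_sparse_mul sp f s : agree f s ->
  agree (sparse_mul sp f) ((\sum_(ec <- sp) sC (psi ec.2) * qv ^+ ec.1) * s).
Proof.
move=> fs; elim: sp => [|ec sp IH].
  by rewrite big_nil mul0r => i _; rewrite cf0 nth_nseq if_same rmorph0.
rewrite big_cons mulrDl addrC -mulrA; apply: agree_axpy => //.
exact: size_sparse_mul.
Qed.

Lemma agree_reduce l L s : l <> 0 -> psi l = 0 -> agree L s -> agree (reduce l L) s.
Proof.
move=> l0 pl Ls i; rewrite size_map => iL; rewrite (nth_map 0) // Ls //.
rewrite {1}(Z.div_mod (nth 0 L i) l l0).
by rewrite -/(_ * _ + _) rmorphD rmorphM pl mul0r add0r.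
Qed.

Lemma cube_termsE n : \sum_(ec <- cube_terms n) sC (psi ec.2) * qv ^+ ec.1 =
  \sum_(j < n) (-1) ^+ j * j.*2.+1%:R * qv ^+ tri j.
Proof.
have E j : sC (psi (if odd j then Z.opp (Z.of_nat j.*2.+1) else Z.of_nat j.*2.+1)) =
    (-1) ^+ j * j.*2.+1%:R :> series R.
  rewrite -signr_odd Z_of_natE -/(- _); case: odd.
    by rewrite expr1 mulN1r !rmorphN !rmorph_nat.
  by rewrite mul1r !rmorph_nat.
rewrite big_map -{1}[n]subn0 -/(index_iota 0 n) big_mkord; apply: eq_bigr => j _.
by rewrite -E.
Qed.

Lemma euler_termsE n :
  \sum_(ec <- euler_terms n) sC (psi ec.2) * qv ^+ ec.1 = pentagonal R n.
Proof.
rewrite big_cons /= rmorph1 mul1r expr0 /pentagonal; congr (_ + _).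
rewrite big_flatten big_map -{1}[n]subn0 -/(index_iota 0 n) big_mkord.
apply: eq_bigr => s _; rewrite 2!big_cons big_nil /= addr0 -mulrDr; congr (_ * _).
rewrite -signr_odd /=; case: odd; rewrite /= ?expr0 ?expr1 ?rmorph1 //.
by rewrite -/(-1 : Z) !rmorphN1.
Qed.

Lemma eqm_cube_terms n :
  eqm (tri n) (euler ^+ 3) (\sum_(ec <- cube_terms n) sC (psi ec.2) * qv ^+ ec.1).
Proof.
rewrite cube_termsE; have nt : (n <= tri n)%N by have := tri_double n; nia.
apply: eqm_trans (@euler_cube R (tri n)) _.
apply: (eqm_sum_tail (F := fun j => (-1) ^+ j * j.*2.+1%:R * qv ^+ tri j)) => // j nj.
rewrite mulrC; apply: eqm_qvX.
by have := tri_double j; have := tri_double n; nia.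
Qed.

Lemma eqm_euler_terms n : eqm (n.+1 * n + tri n.+1) euler
  (\sum_(ec <- euler_terms n) sC (psi ec.2) * qv ^+ ec.1).
Proof.
rewrite euler_termsE; set N := (n.+1 * n + tri n.+1)%N.
have nN : (n <= N)%N by rewrite /N; nia.
apply: eqm_trans (eqm_le (leqnSn N) (@euler_pentagonal R N)) _.
rewrite /pentagonal; apply: eqmD => //.
apply: (eqm_sum_tail (F := fun i => (-1) ^+ i.+1 *
  (qv ^+ (i.+1 * i + tri i.+1) + qv ^+ (i.+1 * i.+1 + tri i.+1)))) => // j nj.
have := tri_double n.+1; have := tri_double j.+1 => tn tj.
rewrite mulrC mulrDl -[X in eqm _ _ X]addr0.
by apply: eqmD; apply: eqm_qvX; rewrite /N; nia.
Qed.

Lemma agree_half_power l u v n3 n1 N : l <> 0 -> psi l = 0 ->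
  (N < tri n3)%N -> (N < n1.+1 * n1 + tri n1.+1)%N ->
  size (half_power l u v n3 n1 N) = N.+1 /\
  agree (half_power l u v n3 n1 N) (euler ^+ (3 * u + v)).
Proof.
move=> l0 pl h3 h1; rewrite addnC exprD exprM /half_power.
have [] : size (iter u (fun f => reduce l (sparse_mul (cube_terms n3) f))
    (Z.one :: nseq N Z.zero)) = N.+1 /\
  agree (iter u (fun f => reduce l (sparse_mul (cube_terms n3) f)) (Z.one :: nseq N Z.zero))
    (euler ^+ 3 ^+ u).
  elim: u => [|u [sz IH]].
    split; first by rewrite /= size_nseq.
    move=> [|i] _; rewrite expr0 cf1 /=; first by rewrite (rmorph1 psi).
    by rewrite nth_nseq; case: ifP => _; rewrite (rmorph0 psi).
  rewrite !iterS; split; first by rewrite size_map size_sparse_mul.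
  apply: agree_reduce => //; rewrite (exprS (euler ^+ 3)).
  apply: (agree_eqm _ (agree_sparse_mul (sp := cube_terms n3) IH)).
  rewrite size_sparse_mul sz; apply: eqmM => //; apply: eqm_sym.
  exact: eqm_le h3 (@eqm_cube_terms n3).
elim: v => [|v IH] sz ag; first by rewrite expr0 mul1r.
have [{}sz' {}IH] := IH sz ag; rewrite iterS; split.
  by rewrite size_map size_sparse_mul.
apply: agree_reduce => //; rewrite exprS -mulrA.
apply: (agree_eqm _ (agree_sparse_mul (sp := euler_terms n1) IH)).
rewrite size_sparse_mul sz'; apply: eqmM => //; apply: eqm_sym.
exact: eqm_le h1 (@eqm_euler_terms n1).
Qed.

Lemma agree_square L s n : agree L s -> (n < size L)%N ->
  cf (s * s) n = psi (square_coef L n).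
Proof.
move=> Ls nL; rewrite square_coefE // rmorph_sum cfM; apply: eq_bigr => i _.
have iL := ltn_ord i.
by rewrite rmorphM !Ls // (leq_ltn_trans _ nL) // leq_subr.
Qed.

End Correctness.

Theorem check_caseP l u v n3 n1 r k : check_case l u v n3 n1 r k ->
  forall n, (l %| 24 * n + 2 * (3 * u + v))%N ->
    (l%:Z %| cf (euler ^+ (2 * (3 * u + v))) n)%Z.
Proof.
set d := (2 * (3 * u + v))%N.
case/and5P => l_pr l4 rl lr /and4P[bound h3 h1 chk].
apply: (euler_pow_dvd l_pr l4) => n nb ln.
(* A prime l > 4 is coprime to 24, so l | 24n + d fixes n modulo l. *)
have [i ni] : exists i, n = (r + l * i)%N.
  have cop : coprime l 24.
    by rewrite prime_coprime // (_ : 24 = 2 ^ 3 * 3)%N // Euclid_dvdM // Euclid_dvdX //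
      !dvdn_prime2 //; case: eqP => [e|_]; [|case: eqP => [e|]//]; rewrite e in l4.
  have : (l %| 24 * (n - n %% l) + (24 * (n %% l) + d))%N.
    by rewrite addnA -mulnDr subnK ?leq_mod.
  have dq : (l %| n - n %% l)%N by rewrite {1}(divn_eq n l) addnK dvdn_mull.
  rewrite dvdn_addr ?dvdn_mull // => lm.
  exists (n %/ l)%N; rewrite {1}(divn_eq n l) addnC mulnC; congr (_ + _)%N.
  have ml : (n %% l < l)%N by rewrite ltn_mod prime_gt0.
  wlog le : / True by apply.
  case: (leqP r (n %% l)) => rm.
    have : (l %| 24 * (n %% l - r))%N.
      rewrite mulnBr -(subnDr d) dvdn_sub //.
    rewrite Gauss_dvdr // => /dvdn_leq; lia.
  have : (l %| 24 * (r - n %% l))%N.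
    rewrite mulnBr -(subnDr d) dvdn_sub //.
  rewrite Gauss_dvdr // => /dvdn_leq; lia.
have ik : (i < k.+1)%N by move: nb bound; rewrite ni; nia.
pose psi : {rmorphism Z -> 'F_l} := (intr : {rmorphism int -> 'F_l}) \o int_of_Z.
have pchF := pchar_Fp l_pr.
have psil : psi (Z.of_nat l) = 0
  by apply/eqP; rewrite Z_of_natE rmorph_nat -(dvdn_pcharf pchF).
have lz : Z.of_nat l <> 0.
  by rewrite Z_of_natE => /eqP; rewrite Num.Theory.pnatr_eq0; lia.
rewrite (dvdz_pcharf pchF) -[_%:~R](cf_smap (intr : {rmorphism int -> 'F_l})).
rewrite rmorphXn /= smap_euler /d mulnC exprM expr2.
have [sz ag] := @agree_half_power _ psi (Z.of_nat l) u v n3 n1 (r + l * k) lz psil h3 h1.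
rewrite (agree_square ag); last by rewrite sz ni ltnS leq_add2l leq_mul2l; lia.
have /(allP chk)/Z.eqb_eq e : n \in [seq (r + l * i)%N | i <- iota 0 k.+1].
  by apply/mapP; exists i; rewrite // mem_iota.
rewrite (Z.div_mod (square_coef (half_power (Z.of_nat l) u v n3 n1 (r + l * k)) n) _ lz) e.
by rewrite -/(_ * _ + _) rmorphD rmorphM psil mul0r add0r rmorph0.
Qed.

(** * Residue classes of exponents *)

Lemma eqn_mod_sub m k n a : (k < m)%N -> (a <= n)%N ->
  ((n - a) %% m == (k + (m - a %% m)) %% m)%N = (n %% m == k)%N.
Proof.
move=> km an; have am : (a %% m < m)%N by rewrite ltn_mod; lia.
rewrite -(eqn_modDr a) subnK // {2}(divn_eq a m).
rewrite (_ : (k + (m - a %% m) + (a %/ m * m + a %% m) = (a %/ m).+1 * m + k)%N).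
  by rewrite modnMDl (modn_small km).
by rewrite mulSn; lia.
Qed.

Section Classes.
Variable R : comNzRingType.
Implicit Types f g : series R.

Definition cls (m i : nat) f : series R :=
  Series (fun n => if (n %% m == i)%N then cf f n else 0).

Lemma cf_cls m i f n : cf (cls m i f) n = if (n %% m == i)%N then cf f n else 0.
Proof. by []. Qed.

Lemma cls_eq0 m i f : (forall n, (n %% m = i)%N -> cf f n = 0) -> cls m i f = 0.
Proof.
by move=> f0; apply: series_ext => n; rewrite cf_cls cf0; case: eqP => // /f0.
Qed.

Lemma cls_mul m k f g : (k < m)%N ->
  cls m k (f * g) = \sum_(i < m) cls m i f * cls m ((k + (m - i)) %% m) g.
Proof.
move=> km; apply: series_ext => n; rewrite cf_cls cf_sum.
under eq_bigr => i _ do rewrite cfM.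
rewrite exchange_big /= -[if _ then _ else _]/(if (n %% m == k)%N then cf (f * g) n else 0).
have m0 : (0 < m)%N by apply: leq_ltn_trans km.
have E (a : 'I_n.+1) :
    \sum_(i < m) cf (cls m i f) a * cf (cls m ((k + (m - i)) %% m) g) (n - a) =
    if (n %% m == k)%N then cf f a * cf g (n - a) else 0.
  have an : (a <= n)%N by rewrite -ltnS.
  rewrite (bigD1 (Ordinal (ltn_pmod a m0))) //= eqxx big1 ?addr0 => [|i /eqP ia].
    rewrite (_ : (_ == _) = (n %% m == k)%N); first by case: eqP; rewrite ?mulr0.
    exact: eqn_mod_sub.
  case: eqP => e; last by rewrite mul0r.
  by case: ia; apply: val_inj.
under eq_bigr => a _ do rewrite E.
by rewrite cfM; case: eqP => // _; rewrite big1.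
Qed.

(** A tuple of equations, so that [rewrite] uses it as a multirule. *)
Lemma cls5_mul f g :
  ((cls 5 0 (f * g) = cls 5 0 f * cls 5 0 g + cls 5 1 f * cls 5 4 g
     + cls 5 2 f * cls 5 3 g + cls 5 3 f * cls 5 2 g + cls 5 4 f * cls 5 1 g)%R *
  (cls 5 1 (f * g) = cls 5 0 f * cls 5 1 g + cls 5 1 f * cls 5 0 g
     + cls 5 2 f * cls 5 4 g + cls 5 3 f * cls 5 3 g + cls 5 4 f * cls 5 2 g)%R *
  (cls 5 2 (f * g) = cls 5 0 f * cls 5 2 g + cls 5 1 f * cls 5 1 g
     + cls 5 2 f * cls 5 0 g + cls 5 3 f * cls 5 4 g + cls 5 4 f * cls 5 3 g)%R *
  (cls 5 3 (f * g) = cls 5 0 f * cls 5 3 g + cls 5 1 f * cls 5 2 g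
     + cls 5 2 f * cls 5 1 g + cls 5 3 f * cls 5 0 g + cls 5 4 f * cls 5 4 g)%R *
  (cls 5 4 (f * g) = cls 5 0 f * cls 5 4 g + cls 5 1 f * cls 5 3 g
     + cls 5 2 f * cls 5 2 g + cls 5 3 f * cls 5 1 g + cls 5 4 f * cls 5 0 g)%R)%type.
Proof.
have E k : (k < 5)%N -> _ := @cls_mul 5 k f g.
by do 4?split; rewrite E // !big_ord_recl big_ord0 addr0 !addrA.
Qed.

Lemma cls7_mul f g :
  ((cls 7 0 (f * g) = cls 7 0 f * cls 7 0 g + cls 7 1 f * cls 7 6 g
     + cls 7 2 f * cls 7 5 g + cls 7 3 f * cls 7 4 g + cls 7 4 f * cls 7 3 g
     + cls 7 5 f * cls 7 2 g + cls 7 6 f * cls 7 1 g)%R *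
  (cls 7 1 (f * g) = cls 7 0 f * cls 7 1 g + cls 7 1 f * cls 7 0 g
     + cls 7 2 f * cls 7 6 g + cls 7 3 f * cls 7 5 g + cls 7 4 f * cls 7 4 g
     + cls 7 5 f * cls 7 3 g + cls 7 6 f * cls 7 2 g)%R *
  (cls 7 2 (f * g) = cls 7 0 f * cls 7 2 g + cls 7 1 f * cls 7 1 g
     + cls 7 2 f * cls 7 0 g + cls 7 3 f * cls 7 6 g + cls 7 4 f * cls 7 5 g
     + cls 7 5 f * cls 7 4 g + cls 7 6 f * cls 7 3 g)%R *
  (cls 7 3 (f * g) = cls 7 0 f * cls 7 3 g + cls 7 1 f * cls 7 2 g
     + cls 7 2 f * cls 7 1 g + cls 7 3 f * cls 7 0 g + cls 7 4 f * cls 7 6 g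
     + cls 7 5 f * cls 7 5 g + cls 7 6 f * cls 7 4 g)%R *
  (cls 7 4 (f * g) = cls 7 0 f * cls 7 4 g + cls 7 1 f * cls 7 3 g
     + cls 7 2 f * cls 7 2 g + cls 7 3 f * cls 7 1 g + cls 7 4 f * cls 7 0 g
     + cls 7 5 f * cls 7 6 g + cls 7 6 f * cls 7 5 g)%R *
  (cls 7 5 (f * g) = cls 7 0 f * cls 7 5 g + cls 7 1 f * cls 7 4 g
     + cls 7 2 f * cls 7 3 g + cls 7 3 f * cls 7 2 g + cls 7 4 f * cls 7 1 g
     + cls 7 5 f * cls 7 0 g + cls 7 6 f * cls 7 6 g)%R *
  (cls 7 6 (f * g) = cls 7 0 f * cls 7 6 g + cls 7 1 f * cls 7 5 g
     + cls 7 2 f * cls 7 4 g + cls 7 3 f * cls 7 3 g + cls 7 4 f * cls 7 2 g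
     + cls 7 5 f * cls 7 1 g + cls 7 6 f * cls 7 0 g)%R)%type.
Proof.
have E k : (k < 7)%N -> _ := @cls_mul 7 k f g.
by do 6?split; rewrite E // !big_ord_recl big_ord0 addr0 !addrA.
Qed.

End Classes.

(** * Divisibility of the coefficients of powers of E along residue classes *)

Section Residues.
Local Notation eta := (euler : series int).

Lemma square_residue (m c i n a : nat) : (0 < m)%N -> (n %% m = i)%N ->
  (c * n + 1 = a ^ 2)%N -> ((a %% m) ^ 2 %% m = (c * i + 1) %% m)%N.
Proof.
by move=> m0 <- e; rewrite modnXm -e -[LHS]modnDml -modnMmr modnDml.
Qed.

Lemma euler_class_eq0 (m i : nat) : (0 < m)%N ->
  all (fun x => x ^ 2 %% m != (24 * i + 1) %% m)%N (iota 0 m) ->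
  forall n, (n %% m = i)%N -> cf eta n = 0.
Proof.
move=> m0 no n ni; apply/eqP/negPn/negP => /cf_euler_square[a e].
have /(allP no) : (a %% m)%N \in iota 0 m by rewrite mem_iota ltn_mod.
by rewrite (square_residue m0 ni e) eqxx.
Qed.

Lemma cube_square j : (8 * tri j + 1 = j.*2.+1 ^ 2)%N.
Proof. by have := tri_double j; rewrite -mulnn; nia. Qed.

Lemma euler_cube_class_eq0 (m i : nat) : (0 < m)%N ->
  all (fun x => x ^ 2 %% m != (8 * i + 1) %% m)%N (iota 0 m) ->
  forall n, (n %% m = i)%N -> cf (eta ^+ 3) n = 0.
Proof.
move=> m0 no n ni; case: (cf_euler_cube int n) => // [[j [nj _]]].
have /(allP no) : (j.*2.+1 %% m)%N \in iota 0 m by rewrite mem_iota ltn_mod.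
by rewrite (square_residue (c := 8) m0 ni) ?eqxx // nj cube_square.
Qed.

(** A nonzero coefficient at n = tri j is 2j + 1 up to sign, and (2j + 1)^2 = 8n + 1. If 8i + 1 is a
    square modulo m only through 0, then m divides 2j + 1. *)
Lemma euler_cube_class_dvd (m i : nat) : (0 < m)%N ->
  all (fun x => (x ^ 2 %% m == (8 * i + 1) %% m) ==> (x == 0))%N (iota 0 m) ->
  forall n, (n %% m = i)%N -> (m%:Z %| cf (eta ^+ 3)%R n)%Z.
Proof.
move=> m0 no n ni; case: (cf_euler_cube int n) => [->|[j [nj ->]]]; first exact: dvdz0.
have /(allP no)/implyP : (j.*2.+1 %% m)%N \in iota 0 m by rewrite mem_iota ltn_mod.
rewrite (square_residue (c := 8) m0 ni) ?eqxx ?nj ?cube_square // => /(_ isT) jm.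
by rewrite dvdz_mull // natz.
Qed.

(* because theta (f^m) = m f^(m-1) theta f *)
Lemma pow_coef_dvd (f : series int) m n : (m%:Z %| n%:Z * cf (f ^+ m) n)%Z.
Proof.
case: m => [|m]; first by rewrite cf1; case: n => [|n] //; rewrite mulr0.
by rewrite -natz -cf_theta thetaX -mulrA cf_natrM natz dvdz_mulr.
Qed.

Lemma pow_support (l e : nat) (f : series int) n : prime l -> ~~ (l %| n)%N ->
  ((l ^ e)%N%:Z %| cf (f ^+ (l ^ e)) n)%Z.
Proof.
move=> l_pr ln; have := pow_coef_dvd f (l ^ e) n.
by rewrite Gauss_dvdzr // coprimezE /= coprimeXl // prime_coprime.
Qed.

(** Modulo M the factor g is a series in q^m, so multiplication by it does not mix residue
    classes. *)
Lemma cfM_class_dvd (M m i : nat) (f g : series int) : (0 < m)%N ->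
  (forall n, (n %% m = i)%N -> (M%:Z %| cf f n)%Z) ->
  (forall n, ~~ (m %| n)%N -> (M%:Z %| cf g n)%Z) ->
  forall n, (n %% m = i)%N -> (M%:Z %| cf (f * g)%R n)%Z.
Proof.
move=> m0 fi g0 n ni; rewrite cfM.
apply: (big_ind (fun x => (M%:Z %| x)%Z)) => [||a _].
- exact: dvdz0.
- by move=> x y; apply: rpredD.
have an : (a <= n)%N by rewrite -ltnS.
case: (boolP (m %| n - a)%N) => [d|nd]; last by rewrite dvdz_mull // g0.
rewrite dvdz_mulr // fi // -ni -[in RHS](subnK an) -modnDml.
by move: d => /eqP ->; rewrite add0n.
Qed.

Lemma euler_pow_class (l e d i c : nat) : prime l -> (0 < e)%N ->
  (forall n, (n %% l = i)%N -> ((l ^ e)%N%:Z %| cf (eta ^+ d)%R n)%Z) ->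
  forall n, (n %% l = i)%N -> ((l ^ e)%N%:Z %| cf (eta ^+ (d + l ^ e * c))%R n)%Z.
Proof.
move=> l_pr e0 di; rewrite exprD [(l ^ e * c)%N]mulnC exprM.
apply: cfM_class_dvd => // [|n ln]; first exact: prime_gt0.
exact: pow_support.
Qed.

(** ** The eighth power modulo 25 *)

Lemma euler8_class n : (n %% 5 = 3)%N -> (25 %| cf (eta ^+ 8)%R n)%Z.
Proof.
move=> n3.
have z3 : cls 5 3 eta = 0 by apply: cls_eq0; apply: euler_class_eq0.
have z4 : cls 5 4 eta = 0 by apply: cls_eq0; apply: euler_class_eq0.
have C2 : cls 5 2 (eta ^+ 3) = 0 by apply: cls_eq0; apply: euler_cube_class_eq0.
have a0 : GRing.lreg (cls 5 0 eta).
  by apply: lreg_const1; rewrite cf_cls cf_euler0.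
set a := cls 5 0 eta in a0 *; set b := cls 5 1 eta; set c := cls 5 2 eta.
have S0 : cls 5 0 (eta * eta) = a ^+ 2.
  by rewrite cls5_mul ?z3 ?z4 -/a -/b -/c; ring.
have S1 : cls 5 1 (eta * eta) = 2 * (a * b).
  by rewrite cls5_mul ?z3 ?z4 -/a -/b -/c; ring.
have S2 : cls 5 2 (eta * eta) = 2 * (a * c) + b ^+ 2.
  by rewrite cls5_mul ?z3 ?z4 -/a -/b -/c; ring.
have S3 : cls 5 3 (eta * eta) = 2 * (b * c).
  by rewrite cls5_mul ?z3 ?z4 -/a -/b -/c; ring.
have S4 : cls 5 4 (eta * eta) = c ^+ 2.
  by rewrite cls5_mul ?z3 ?z4 -/a -/b -/c; ring.
have SE := (S0, S1, S2, S3, S4).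
have T0 : cls 5 0 (eta * eta * (eta * eta)) = a ^+ 4 + 12 * (a * b * c ^+ 2)
    + 4 * (b ^+ 3 * c).
  by rewrite cls5_mul !SE; ring.
have T1 : cls 5 1 (eta * eta * (eta * eta)) = 4 * (a ^+ 3 * b) + 4 * (a * c ^+ 3)
    + 6 * (b ^+ 2 * c ^+ 2).
  by rewrite cls5_mul !SE; ring.
have T2 : cls 5 2 (eta * eta * (eta * eta)) = 4 * (a ^+ 3 * c) + 6 * (a ^+ 2 * b ^+ 2)
    + 4 * (b * c ^+ 3).
  by rewrite cls5_mul !SE; ring.
have T3 : cls 5 3 (eta * eta * (eta * eta)) = 12 * (a ^+ 2 * b * c) + 4 * (a * b ^+ 3)
    + c ^+ 4.
  by rewrite cls5_mul !SE; ring.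
have T4 : cls 5 4 (eta * eta * (eta * eta)) = 6 * (a ^+ 2 * c ^+ 2)
    + 12 * (a * b ^+ 2 * c) + b ^+ 4.
  by rewrite cls5_mul !SE; ring.
rewrite (_ : eta ^+ 3 = eta * (eta * eta)) ?cls5_mul ?z3 ?z4 ?SE -/a -/b -/c in C2; last by ring.
have cE : cls 5 3 (eta ^+ 8) = cls 5 3 (eta * eta * (eta * eta) * (eta * eta * (eta * eta))).
  by congr cls; ring.
rewrite cls5_mul T0 T1 T2 T3 T4 in cE.
clearbody a b c.
(* Class 2 of E^3 is 3a(ac + b^2), and it vanishes by Jacobi's identity. *)
have H : a * c + b ^+ 2 = 0.
  have : 3 * (a * (a * c + b ^+ 2)) = 0 by rewrite -[RHS]C2; ring.
  have r3 : GRing.lreg (3 : series int).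
    apply: (@lreg_order _ 0) => //; rewrite cf_natr; apply/lregP; exact/eqP.
  by rewrite -[RHS](mulr0 3) => /r3; rewrite -[RHS](mulr0 a) => /a0.
(* When ac + b^2 = 0 the component collapses to -125 b^8; the bracket is the quotient of the
   division. *)
have {}cE : cls 5 3 (eta ^+ 8) = (
      (126) * b ^+ 6 + (-70) * a * b ^+ 4 * c + (490) * a ^+ 2 * b ^+ 2 * c ^+ 2
      + (56) * b * c ^+ 5 + (56) * a ^+ 5 * b + (70) * a ^+ 3 * c ^+ 3) * (a * c + b ^+ 2) - 125 * b ^+ 8 by rewrite cE; ring.
move: cE; rewrite H mulr0 sub0r => /(congr1 (fun f => cf f n)); rewrite cf_cls n3 eqxx => ->.
by rewrite cfN cf_natrM -mulNr dvdz_mulr.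
Qed.

(** ** The powers 10 and 24 modulo 49 *)

Lemma cf_euler5 : cf eta 5 = 1.
Proof.
rewrite -(cf_euler_part _ (leqnn 5)) /euler_part !big_ord_recr big_ord0.
rewrite [X in cf X _](_ : _ = 1 - qv ^+ 1 - qv ^+ 2 + qv ^+ 5 + qv ^+ 6 *
  (1 + qv - qv ^+ 2 - qv ^+ 3 - qv ^+ 4 + qv ^+ 7 + qv ^+ 8 - qv ^+ 9)); last by rewrite /=; ring.
by rewrite !cfD !cfN cf1 !cf_qvX cf_qvXM.
Qed.

Lemma euler10_class n : (n %% 7 = 6)%N -> (49 %| cf (eta ^+ 10)%R n)%Z.
Proof.
move=> n6.
have z3 : cls 7 3 eta = 0 by apply: cls_eq0; apply: euler_class_eq0.
have z4 : cls 7 4 eta = 0 by apply: cls_eq0; apply: euler_class_eq0.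
have z6 : cls 7 6 eta = 0 by apply: cls_eq0; apply: euler_class_eq0.
have C2 : cls 7 2 (eta ^+ 3) = 0 by apply: cls_eq0; apply: euler_cube_class_eq0.
have C4 : cls 7 4 (eta ^+ 3) = 0 by apply: cls_eq0; apply: euler_cube_class_eq0.
have C5 : cls 7 5 (eta ^+ 3) = 0 by apply: cls_eq0; apply: euler_cube_class_eq0.
have d0 : GRing.lreg (cls 7 5 eta).
  apply: (@lreg_order _ 5) => [i i5|]; rewrite cf_cls.
    by rewrite modn_small ?(ltn_eqF i5) //; lia.
  by rewrite cf_euler5; apply: lreg1.
set a := cls 7 0 eta; set b := cls 7 1 eta; set c := cls 7 2 eta.
set d := cls 7 5 eta in d0 *.
have S0 : cls 7 0 (eta * eta) = a ^+ 2 + 2 * (c * d).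
  by rewrite cls7_mul ?z3 ?z4 ?z6 -/a -/b -/c -/d; ring.
have S1 : cls 7 1 (eta * eta) = 2 * (a * b).
  by rewrite cls7_mul ?z3 ?z4 ?z6 -/a -/b -/c -/d; ring.
have S2 : cls 7 2 (eta * eta) = 2 * (a * c) + b ^+ 2.
  by rewrite cls7_mul ?z3 ?z4 ?z6 -/a -/b -/c -/d; ring.
have S3 : cls 7 3 (eta * eta) = 2 * (b * c) + d ^+ 2.
  by rewrite cls7_mul ?z3 ?z4 ?z6 -/a -/b -/c -/d; ring.
have S4 : cls 7 4 (eta * eta) = c ^+ 2.
  by rewrite cls7_mul ?z3 ?z4 ?z6 -/a -/b -/c -/d; ring.
have S5 : cls 7 5 (eta * eta) = 2 * (a * d).
  by rewrite cls7_mul ?z3 ?z4 ?z6 -/a -/b -/c -/d; ring.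
have S6 : cls 7 6 (eta * eta) = 2 * (b * d).
  by rewrite cls7_mul ?z3 ?z4 ?z6 -/a -/b -/c -/d; ring.
have SE := (S0, S1, S2, S3, S4, S5, S6).
have V0 : cls 7 0 (eta * (eta * eta)) = a ^+ 3 + 6 * (a * c * d) + 3 * (b ^+ 2 * d).
  by rewrite cls7_mul ?z3 ?z4 ?z6 !SE -/a -/b -/c -/d; ring.
have V1 : cls 7 1 (eta * (eta * eta)) = 3 * (a ^+ 2 * b) + 6 * (b * c * d) + d ^+ 3.
  by rewrite cls7_mul ?z3 ?z4 ?z6 !SE -/a -/b -/c -/d; ring.
have V2 : cls 7 2 (eta * (eta * eta)) = 3 * (a ^+ 2 * c) + 3 * (a * b ^+ 2)
    + 3 * (c ^+ 2 * d).
  by rewrite cls7_mul ?z3 ?z4 ?z6 !SE -/a -/b -/c -/d; ring.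
have V3 : cls 7 3 (eta * (eta * eta)) = 6 * (a * b * c) + 3 * (a * d ^+ 2) + b ^+ 3.
  by rewrite cls7_mul ?z3 ?z4 ?z6 !SE -/a -/b -/c -/d; ring.
have V4 : cls 7 4 (eta * (eta * eta)) = 3 * (a * c ^+ 2) + 3 * (b ^+ 2 * c)
    + 3 * (b * d ^+ 2).
  by rewrite cls7_mul ?z3 ?z4 ?z6 !SE -/a -/b -/c -/d; ring.
have V5 : cls 7 5 (eta * (eta * eta)) = 3 * (a ^+ 2 * d) + 3 * (b * c ^+ 2)
    + 3 * (c * d ^+ 2).
  by rewrite cls7_mul ?z3 ?z4 ?z6 !SE -/a -/b -/c -/d; ring.
have V6 : cls 7 6 (eta * (eta * eta)) = 6 * (a * b * d) + c ^+ 3.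
  by rewrite cls7_mul ?z3 ?z4 ?z6 !SE -/a -/b -/c -/d; ring.
have VE := (V0, V1, V2, V3, V4, V5, V6).
have U0 : cls 7 0 (eta * eta * (eta * (eta * eta))) = a ^+ 5 + 20 * (a ^+ 3 * c * d)
    + 30 * (a ^+ 2 * b ^+ 2 * d) + 20 * (a * b * c ^+ 3) + 30 * (a * c ^+ 2 * d ^+ 2)
    + 10 * (b ^+ 3 * c ^+ 2) + 30 * (b ^+ 2 * c * d ^+ 2) + 5 * (b * d ^+ 4).
  by rewrite cls7_mul !SE !VE; ring.
have U1 : cls 7 1 (eta * eta * (eta * (eta * eta))) = 5 * (a ^+ 4 * b)
    + 60 * (a ^+ 2 * b * c * d) + 10 * (a ^+ 2 * d ^+ 3) + 20 * (a * b ^+ 3 * d)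
    + 5 * (a * c ^+ 4) + 10 * (b ^+ 2 * c ^+ 3) + 30 * (b * c ^+ 2 * d ^+ 2)
    + 5 * (c * d ^+ 4).
  by rewrite cls7_mul !SE !VE; ring.
have U2 : cls 7 2 (eta * eta * (eta * (eta * eta))) = 5 * (a ^+ 4 * c)
    + 10 * (a ^+ 3 * b ^+ 2) + 30 * (a ^+ 2 * c ^+ 2 * d) + 60 * (a * b ^+ 2 * c * d)
    + 20 * (a * b * d ^+ 3) + 5 * (b ^+ 4 * d) + 5 * (b * c ^+ 4)
    + 10 * (c ^+ 3 * d ^+ 2).
  by rewrite cls7_mul !SE !VE; ring.
have U3 : cls 7 3 (eta * eta * (eta * (eta * eta))) = 20 * (a ^+ 3 * b * c)
    + 10 * (a ^+ 3 * d ^+ 2) + 10 * (a ^+ 2 * b ^+ 3) + 60 * (a * b * c ^+ 2 * d)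
    + 20 * (a * c * d ^+ 3) + 20 * (b ^+ 3 * c * d) + 10 * (b ^+ 2 * d ^+ 3) + c ^+ 5.
  by rewrite cls7_mul !SE !VE; ring.
have U4 : cls 7 4 (eta * eta * (eta * (eta * eta))) = 10 * (a ^+ 3 * c ^+ 2)
    + 30 * (a ^+ 2 * b ^+ 2 * c) + 30 * (a ^+ 2 * b * d ^+ 2) + 5 * (a * b ^+ 4)
    + 20 * (a * c ^+ 3 * d) + 30 * (b ^+ 2 * c ^+ 2 * d) + 20 * (b * c * d ^+ 3)
    + d ^+ 5.
  by rewrite cls7_mul !SE !VE; ring.
have U5 : cls 7 5 (eta * eta * (eta * (eta * eta))) = 5 * (a ^+ 4 * d)
    + 30 * (a ^+ 2 * b * c ^+ 2) + 30 * (a ^+ 2 * c * d ^+ 2) + 20 * (a * b ^+ 3 * c)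
    + 30 * (a * b ^+ 2 * d ^+ 2) + b ^+ 5 + 20 * (b * c ^+ 3 * d)
    + 10 * (c ^+ 2 * d ^+ 3).
  by rewrite cls7_mul !SE !VE; ring.
have U6 : cls 7 6 (eta * eta * (eta * (eta * eta))) = 20 * (a ^+ 3 * b * d)
    + 10 * (a ^+ 2 * c ^+ 3) + 30 * (a * b ^+ 2 * c ^+ 2) + 60 * (a * b * c * d ^+ 2)
    + 5 * (a * d ^+ 4) + 5 * (b ^+ 4 * c) + 10 * (b ^+ 3 * d ^+ 2) + 5 * (c ^+ 4 * d).
  by rewrite cls7_mul !SE !VE; ring.
have e3 : eta ^+ 3 = eta * (eta * eta) by ring.
rewrite e3 VE in C2; rewrite e3 VE in C4; rewrite e3 VE in C5.
have cE : cls 7 6 (eta ^+ 10) = cls 7 6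
    (eta * eta * (eta * (eta * eta)) * (eta * eta * (eta * (eta * eta)))).
  by congr cls; ring.
rewrite cls7_mul U0 U1 U2 U3 U4 U5 U6 in cE.
clearbody a b c d.
have r3 : GRing.lreg (3 : series int).
  apply: (@lreg_order _ 0) => //; rewrite cf_natr; apply/lregP; exact/eqP.
have H2 : a ^+ 2 * c + a * b ^+ 2 + c ^+ 2 * d = 0.
  by apply: r3; rewrite mulr0 -[RHS]C2; ring.
have H4 : a * c ^+ 2 + b ^+ 2 * c + b * d ^+ 2 = 0.
  by apply: r3; rewrite mulr0 -[RHS]C4; ring.
have H5 : a ^+ 2 * d + b * c ^+ 2 + c * d ^+ 2 = 0.
  by apply: r3; rewrite mulr0 -[RHS]C5; ring.
(* c times the first relation minus a times the second is d(c^3 - abd); d is regular because it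
   starts with q^5. *)
have Hc : c ^+ 3 - a * b * d = 0.
  apply: d0; transitivity (c * (a ^+ 2 * c + a * b ^+ 2 + c ^+ 2 * d)
    - a * (a * c ^+ 2 + b ^+ 2 * c + b * d ^+ 2)); first by ring.
  by rewrite H2 H4; ring.
(* the cofactors were found by linear algebra modulo 49 *)
have {}cE : cls 7 6 (eta ^+ 10) = (
      (22) * (c * d ^+ 6) + (-13) * (b * c ^+ 2 * d ^+ 4)
      + (-6) * (b ^+ 2 * c ^+ 3 * d ^+ 2) + (-21) * (b ^+ 3 * c ^+ 4)
      + (-8) * (b ^+ 6 * d) + (8) * (a * c ^+ 4 * d ^+ 2) + (7) * (a * b * c ^+ 5)
      + (-20) * (a * b ^+ 3 * d ^+ 3) + (-13) * (a * b ^+ 4 * c * d)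
      + (21) * (a ^+ 2 * d ^+ 5) + (13) * (a ^+ 2 * b * c * d ^+ 3)
      + (14) * (a ^+ 2 * b ^+ 2 * c ^+ 2 * d) + (13) * (a ^+ 3 * c ^+ 3 * d)
      + (14) * (a ^+ 3 * b ^+ 4) + (-20) * (a ^+ 4 * b * d ^+ 2)
      + (-20) * (a ^+ 4 * b ^+ 2 * c) + (22) * (a ^+ 5 * c ^+ 2)) * (a ^+ 2 * c + a * b ^+ 2 + c ^+ 2 * d)
      + (
      - (c ^+ 4 * d ^+ 3) + (-21) * (b * c ^+ 5 * d) + (14) * (b ^+ 3 * d ^+ 4)
      + (21) * (b ^+ 4 * c * d ^+ 2) + (21) * (b ^+ 5 * c ^+ 2) + (-8) * (a * d ^+ 6)
      + (7) * (a * b * c * d ^+ 4) + (19) * (a * b ^+ 2 * c ^+ 2 * d ^+ 2)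
      + (-14) * (a * b ^+ 3 * c ^+ 3) + (-8) * (a ^+ 2 * b ^+ 4 * d)
      + (-8) * (a ^+ 5 * b ^+ 2)) * (a * c ^+ 2 + b ^+ 2 * c + b * d ^+ 2)
      + (
      (b ^+ 6 * c) + (14) * (a ^+ 4 * d ^+ 3) + (-8) * (a ^+ 6 * b)) * (a ^+ 2 * d + b * c ^+ 2 + c * d ^+ 2)
      + c ^+ 7 * (c ^+ 3 - a * b * d)
      + 49 * (
      (2) * (c ^+ 3 * d ^+ 7) + (26) * (b * c ^+ 4 * d ^+ 5)
      + (52) * (b ^+ 2 * c ^+ 5 * d ^+ 3) + (18) * (b ^+ 3 * c ^+ 6 * d)
      + (4) * (b ^+ 4 * d ^+ 6) + (25) * (b ^+ 5 * c * d ^+ 4)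
      + (25) * (b ^+ 6 * c ^+ 2 * d ^+ 2) + (2) * (b ^+ 7 * c ^+ 3)
      + (17) * (a * c ^+ 6 * d ^+ 3) + (2) * (a * b * d ^+ 8)
      + (15) * (a * b * c ^+ 7 * d) + (51) * (a * b ^+ 2 * c * d ^+ 6)
      + (257) * (a * b ^+ 3 * c ^+ 2 * d ^+ 4) + (257) * (a * b ^+ 4 * c ^+ 3 * d ^+ 2)
      + (26) * (a * b ^+ 5 * c ^+ 4) + (2) * (a * b ^+ 8 * d)
      + (25) * (a ^+ 2 * c ^+ 2 * d ^+ 6) + (257) * (a ^+ 2 * b * c ^+ 3 * d ^+ 4)
      + (385) * (a ^+ 2 * b ^+ 2 * c ^+ 4 * d ^+ 2) + (52) * (a ^+ 2 * b ^+ 3 * c ^+ 5)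
      + (52) * (a ^+ 2 * b ^+ 5 * d ^+ 3) + (52) * (a ^+ 2 * b ^+ 6 * c * d)
      + (51) * (a ^+ 3 * c ^+ 5 * d ^+ 2) + (17) * (a ^+ 3 * b * c ^+ 6)
      + (51) * (a ^+ 3 * b ^+ 2 * d ^+ 5) + (343) * (a ^+ 3 * b ^+ 3 * c * d ^+ 3)
      + (257) * (a ^+ 3 * b ^+ 4 * c ^+ 2 * d) + (25) * (a ^+ 4 * c * d ^+ 5)
      + (257) * (a ^+ 4 * b * c ^+ 2 * d ^+ 3) + (257) * (a ^+ 4 * b ^+ 2 * c ^+ 3 * d)
      + (4) * (a ^+ 4 * b ^+ 6) + (25) * (a ^+ 5 * c ^+ 4 * d)
      + (52) * (a ^+ 5 * b ^+ 3 * d ^+ 2) + (26) * (a ^+ 5 * b ^+ 4 * c)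
      + (4) * (a ^+ 6 * d ^+ 4) + (52) * (a ^+ 6 * b * c * d ^+ 2)
      + (26) * (a ^+ 6 * b ^+ 2 * c ^+ 2) + (2) * (a ^+ 7 * c ^+ 3)
      + (2) * (a ^+ 8 * b * d)) by rewrite cE; ring.
move: cE; rewrite H2 H4 H5 Hc !mulr0 !add0r => /(congr1 (fun f => cf f n)).
by rewrite cf_cls n6 eqxx => ->; rewrite cf_natrM dvdz_mulr.
Qed.

End Residues.

Section Power24.
Local Notation eta := (euler : series int).

(** Modulo l the coefficient of q^(lm) in f^l is the l-th power of the coefficient of q^m in f. The
    truncation g makes f a finite sum, to which Frobenius applies additively. *)
Lemma frobenius_coef (l m : nat) (f : series int) : prime l ->
  (l%:Z %| cf f m)%Z -> (l%:Z %| cf (f ^+ l)%R (l * m))%Z.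
Proof.
move=> l_pr; have pchF := pchar_Fp l_pr.
have pchS : l \in [pchar series 'F_l].
  by rewrite inE l_pr (natr_pchar_series pchF (dvdnn l)) eqxx.
rewrite !(dvdz_pcharf pchF); pose phi := smap (intr : {rmorphism int -> 'F_l}).
rewrite -[_%:~R]/(cf (phi f) m) -[X in _ -> X == _]/(cf (phi (f ^+ l)) (l * m)).
rewrite [phi (f ^+ l)](_ : _ = phi f ^+ l); last exact: rmorphXn.
move: (phi f) => {}f /eqP fm; apply/eqP.
pose g : series 'F_l := \sum_(i < (l * m).+1) sC (cf f i) * qv ^+ i.
have fg : eqm (l * m).+1 f g.
  move=> n nm; rewrite /g cf_sum (bigD1 (Ordinal nm)) // cf_sCM cf_qvX eqxx mulr1.
  rewrite big1 => [|i]; first by rewrite /= addr0.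
  by rewrite -(inj_eq val_inj) cf_sCM cf_qvX eq_sym => /negPf ->; rewrite mulr0.
have l0 := prime_gt0 l_pr.
rewrite (eqmX l fg) // -(pFrobenius_autE pchS) /g raddf_sum /= cf_sum big1 // => i _.
rewrite pFrobenius_autE exprMn -exprM -rmorphXn cf_sCM cf_qvX [(i * l)%N]mulnC eqn_pmul2l //.
by case: eqP => [<-|]; rewrite ?mulr0 // fm expr0n (gtn_eqF l0) mul0r.
Qed.

(** With W = E^7, Taylor expansion at w0 gives W^3 = 3 w0^2 W - 2 w0^3 modulo 49; multiply by
    E^3. *)
Lemma euler24_expansion (w0 u : series int) : eta ^+ 7 = w0 + 7 * u ->
  exists v, eta ^+ 24 = w0 ^+ 2 * (3 * eta ^+ 10) - 2 * (w0 ^+ 3 * eta ^+ 3) + 49 * v.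
Proof.
move=> w; exists (eta ^+ 3 * (3 * w0 * u ^+ 2 + 7 * u ^+ 3)).
rewrite (_ : eta ^+ 24 = eta ^+ 3 * (eta ^+ 7) ^+ 3); last by ring.
by rewrite w (_ : eta ^+ 10 = eta ^+ 3 * eta ^+ 7); [rewrite w|]; ring.
Qed.

(** If n = 6 modulo 7 then 7 | 8n + 1; were this a square, 49 would divide it, forcing n = 6 modulo
    49. *)
Lemma cube_class6 n : (n %% 7 = 6)%N -> (n %% 49 <> 6)%N -> cf (eta ^+ 3) n = 0.
Proof.
move=> n6 n49; case: (cf_euler_cube int n) => // [[j [nj _]]].
have := cube_square j; rewrite -nj => e.
have : (7 %| j.*2.+1 ^ 2)%N by rewrite -e (divn_eq n 7) n6; apply/dvdnP; exists (8 * (n %/ 7) + 7)%N; lia.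
rewrite Euclid_dvdX // => /andP[/dvdnP[a ja] _]; case: n49.
move: e; rewrite ja -mulnn (_ : a * 7 * (a * 7) = 49 * (a * a))%N; last by ring.
by move: (a * a)%N => x; lia.
Qed.

(** In the expansion of E^24 the first term is settled by [euler10_class], because w0 is a series in
    q^7. In the second, E^3 contributes in class 6 modulo 7 only at exponents i = 6 modulo 49, with
    a coefficient divisible by 7; the cofactor is then taken at an exponent 7s modulo 49 and
    supplies the second 7. *)
Lemma euler24_class (c n s : nat) : s \in [:: 2; 4; 5; 6]%N ->
  (n %% 49 = 7 * s + 6)%N -> (49 %| cf (eta ^+ (24 + 49 * c))%R n)%Z.
Proof.
move=> s4 ns.
have s7 : (s < 7)%N by move: s4; rewrite !inE; do 4?[case/orP] => /eqP ->.
have n6 : (n %% 7 = 6)%N.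
  by rewrite -(modn_dvdm n (isT : 7 %| 49)%N) ns mulnC modnMDl.
have sup49 m : ~~ (7 %| m)%N -> (49 %| cf (eta ^+ (49 * c))%R m)%Z.
  by move=> m7; rewrite mulnC exprM; apply: (@pow_support 7 2).
have [u wu] : exists u, eta ^+ 7 = cls 7 0 (eta ^+ 7) + 7 * u.
  pose F m := if (m %% 7 == 0)%N then 0 else (cf (eta ^+ 7)%R m %/ 7)%Z.
  exists (Series F); apply: series_ext => m.
  rewrite cfD cf_cls cf_natrM -[cf (Series F) m]/(F m) /F.
  case: eqP => m7; first by rewrite mulr0 addr0.
  rewrite add0r mulrC divzK //.
  by apply: (@pow_support 7 1); rewrite // /dvdn; apply/eqP.
set w0 := cls 7 0 (eta ^+ 7) in wu.
have w0_sup m : ~~ (7 %| m)%N -> cf w0 m = 0.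
  by rewrite cf_cls /dvdn => /negPf ->.
have sup (k m : nat) : ~~ (7 %| m)%N -> (49 %| cf (w0 ^+ k * eta ^+ (49 * c))%R m)%Z.
  elim: k m => [|k IH] m m7; first by rewrite mul1r sup49.
  rewrite exprS -mulrA cfM; apply: (big_ind (fun x => (49 %| x)%Z)) => [||i _].
  - exact: dvdz0.
  - by move=> x y; apply: rpredD.
  have im : (i <= m)%N by rewrite -ltnS.
  case: (boolP (7 %| i)%N) => [i7|/w0_sup ->]; last by rewrite mul0r dvdz0.
  rewrite dvdz_mull // IH //; apply: contra m7 => mi7.
  by rewrite -(subnK im) dvdn_add.
(* Modulo 7 this series is the seventh power of E^(3+7c), so Frobenius leads back to class s of E^3,
   which vanishes modulo 7 for these s. *)
have supY m : (m %% 49 = 7 * s)%N -> (7 %| cf (w0 ^+ 3 * eta ^+ (49 * c))%R m)%Z.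
  move=> ms; have [k mk] : exists k, m = (7 * (7 * k + s))%N.
    by exists (m %/ 49)%N; rewrite {1}(divn_eq m 49) ms; lia.
  have e : (eta ^+ (3 + 7 * c)) ^+ 7 = w0 ^+ 3 * eta ^+ (49 * c)
      + 7 * ((3 * w0 ^+ 2 * u + 21 * w0 * u ^+ 2 + 49 * u ^+ 3) * eta ^+ (49 * c)).
    transitivity ((eta ^+ 7) ^+ 3 * eta ^+ (49 * c)); last by rewrite wu; ring.
    by rewrite -!exprM -exprD; congr (_ ^+ _); lia.
  have : (7 %| cf ((eta ^+ (3 + 7 * c)) ^+ 7)%R m)%Z.
    rewrite mk; apply: frobenius_coef => //.
    apply: (@euler_pow_class 7 1 3 s c) => //; last by rewrite mulnC modnMDl modn_small.
    apply: (@euler_cube_class_dvd 7 s) => //.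
    by move: s4; rewrite !inE; do 3?[case/orP]; move=> /eqP ->.
  by rewrite e cfD cf_natrM rpredDr // dvdz_mulr.
have [v ev] := euler24_expansion wu.
rewrite exprD ev (_ : _ * _ = 3 * (eta ^+ 10 * (w0 ^+ 2 * eta ^+ (49 * c)))
  - 2 * (eta ^+ 3 * (w0 ^+ 3 * eta ^+ (49 * c))) + 49 * (v * eta ^+ (49 * c))); last by ring.
rewrite cfD cfB !cf_natrM; apply: rpredD; last by rewrite dvdz_mulr.
apply: rpredB; apply: dvdz_mull.
  by apply: (@cfM_class_dvd 49 7 6) => //; [apply: euler10_class|apply: sup].
rewrite cfM; apply: (big_ind (fun x => (49 %| x)%Z)) => [||i _].
- exact: dvdz0.
- by move=> x y; apply: rpredD.
have i_n : (i <= n)%N by rewrite -ltnS.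
case: (boolP (7 %| n - i)%N) => [d7|]; last by move=> d7; rewrite dvdz_mull // sup.
have i6 : (i %% 7 = 6)%N.
  by rewrite -[RHS]n6 -[in RHS](subnK i_n) -modnDml; move: d7 => /eqP ->; rewrite add0n.
have [i49|/eqP i49] := eqVneq (i %% 49)%N 6%N; last first.
  by rewrite cube_class6 ?mul0r ?dvdz0.
suff : ((7%Z * 7%Z)%R %|
    cf (eta ^+ 3)%R i * cf (w0 ^+ 3 * eta ^+ (49 * c))%R (n - i))%Z by [].
apply: dvdz_mul.
  by apply: (@euler_cube_class_dvd 7 6).
by apply: supY; move: ns i49 i_n s7; lia.
Qed.

End Power24.

(** * From rational exponents to natural exponents *)

(** For fixed n, p_k(n) is a polynomial in k, which is what allows exponents that are l-adically
    close to be compared. *)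
Definition gbinom_poly (i : nat) : {poly rat} :=
  (i`!%:R^-1)%:P * \prod_(j < i) ('X - j%:R%:P).

Definition binom_poly (m n : nat) : {poly rat} :=
  if (m %| n)%N then (-1) ^+ (n %/ m) *: gbinom_poly (n %/ m) else 0.

Fixpoint part_poly (N : nat) : nat -> {poly rat} :=
  if N is N'.+1 then
    fun n => \sum_(i < n.+1) part_poly N' i * binom_poly N'.+1 (n - i)
  else fun n => (n == 0%N)%:R.

Lemma gbinom_polyE k i : gbinom k i = (gbinom_poly i).[k].
Proof.
rewrite /gbinom /gbinom_poly hornerM hornerC horner_prod mulrC; congr (_ * _).
by apply: eq_bigr => j _; rewrite !hornerE.
Qed.

Lemma binom_polyE k m n : binom_series k m n = (binom_poly m n).[k].
Proof.
rewrite /binom_series /binom_poly; case: ifP => _; last by rewrite horner0.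
by rewrite hornerZ -gbinom_polyE mulrC.
Qed.

Lemma part_polyE k N n : qpoch_pow_part k N n = (part_poly N n).[k].
Proof.
elim: N n => [|N IH] n /=; first by rewrite /fps_one; case: eqP; rewrite !hornerE.
rewrite /fps_mul horner_sum; apply: eq_bigr => i _.
by rewrite hornerM -IH -binom_polyE.
Qed.

Lemma gbinom_nat (K i : nat) : gbinom K%:R i = 'C(K, i)%:R.
Proof.
rewrite /gbinom; apply: (canLR (mulfK _)); first by rewrite pnatr_eq0 -lt0n fact_gt0.
rewrite -natrM bin_ffact ffact_prod natr_prod; elim: i => [|i IH]; first by rewrite !big_ord0.
rewrite !big_ord_recr /= IH; have [iK|Ki] := leqP i K; first by rewrite natrB.
by rewrite (bigD1 (Ordinal Ki)) //= subnn !mul0r.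
Qed.

Lemma binom_series_nat (K m n : nat) : (0 < m)%N ->
  binom_series K%:R m n = cf ((1 - qv ^+ m) ^+ K : series rat) n.
Proof.
move=> m0; rewrite exprBn cf_sum /binom_series.
have E (i : 'I_K.+1) : cf ((-1) ^+ i * 1 ^+ (K - i) * (qv ^+ m) ^+ i *+ 'C(K, i)) n =
    ((-1) ^+ i * 'C(K, i)%:R) *+ (n == m * i)%N :> rat.
  rewrite cfMn expr1n mulr1 -exprM.
  have -> : (-1) ^+ i = sC ((-1) ^+ i) :> series rat by rewrite rmorphXn rmorphN1.
  by rewrite cf_sCM cf_qvX mulr_natr -mulrnA mulnC mulrnA mulr_natr.
rewrite (eq_bigr _ (fun i _ => E i)); case: ifP => [/dvdnP[j ->]|mn]; last first.
  by rewrite big1 // => i _; case: eqP => // e; rewrite e dvdn_mulr in mn.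
rewrite mulnK // gbinom_nat; have [jK|Kj] := leqP j K.
  rewrite (bigD1 (inord j)) //= inordK // mulnC eqxx mulrC big1 ?addr0 // => i ij.
  rewrite eqn_pmul2l //; case: eqP => // e; case/eqP: ij; apply: val_inj.
  by rewrite /= inordK // e.
rewrite bin_small // mul0r big1 // => i _; rewrite mulnC eqn_pmul2l //.
by case: eqP => // e; have := ltn_ord i; rewrite -e ltnS leqNgt Kj.
Qed.

Lemma qpoch_pow_part_nat (K N n : nat) :
  qpoch_pow_part K%:R N n = cf (euler_part N ^+ K : series rat) n.
Proof.
elim: N n => [|N IH] n; first by rewrite /euler_part big_ord0 expr1n cf1.
rewrite euler_partS exprMn cfM /= /fps_mul; apply: eq_bigr => i _.
by rewrite IH binom_series_nat.
Qed.

Lemma p_nat (K n : nat) : p K%:R n = (cf (euler ^+ K) n)%:~R.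
Proof.
rewrite /p qpoch_pow_part_nat.
rewrite (eqmX K (@eqm_euler _ n)) // -(smap_euler (intr : {rmorphism int -> rat})).
by rewrite -rmorphXn.
Qed.

Lemma p_polyE k n : p k n = (part_poly n n).[k].
Proof. exact: part_polyE. Qed.

Lemma ratcong0_frac (M : nat) (u v : int) (x : rat) :
  v != 0 -> coprimez v M%:Z -> x * v%:~R = (M%:Z * u)%:~R -> ratcong0 M x.
Proof.
move=> v0 cop xv.
have e : numq x * v = M%:Z * u * denq x.
  by apply/eqP; rewrite -(eqr_int rat); apply/eqP; rewrite intrM numqE [RHS]intrM -xv mulrAC.
split.
  apply: (coprimez_dvdl _ cop).
  have : (denq x %| numq x * v)%Z by rewrite e dvdz_mull.
  by rewrite Gauss_dvdzr // coprimezE coprime_sym coprime_num_den.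
have : (M%:Z %| numq x * v)%Z by rewrite e -mulrA dvdz_mulr.
by rewrite Gauss_dvdzl // coprimez_sym.
Qed.

(** x - y divides g(x) - g(y), homogenized: multiplying by a power of b clears the denominators of x
    = -a/b, and b(x - K) = -(a + bK). *)
Lemma int_poly_diff (g : {poly int}) (a b : int) (K : nat) : b != 0 -> exists z : int,
  b%:~R ^+ size g * ((map_poly intr g).[- (a%:~R / b%:~R)] - (map_poly intr g).[K%:R])
  = ((a + b * K%:Z) * z)%:~R :> rat.
Proof.
move=> b0; have b0' : b%:~R != 0 :> rat by rewrite intr_eq0.
pose S : int := \sum_(i < size g) g`_i * b ^+ (size g - i) * ((- a) ^+ i - (b * K%:Z) ^+ i).
have /dvdzP[z Sz] : (a + b * K%:Z %| S)%Z.
  rewrite /S; apply: (big_ind (fun x => (a + b * K%:Z %| x)%Z)) => [||i _].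
  - exact: dvdz0.
  - by move=> x y; apply: rpredD.
  by rewrite dvdz_mull // subrXX dvdz_mulr // -opprD rpredN.
exists z; rewrite [(a + _) * z]mulrC -Sz /S rmorph_sum /=.
have sz : (size (map_poly intr g : {poly rat}) <= size g)%N by apply: size_poly.
rewrite !(horner_coef_wide _ sz) -sumrB mulr_sumr; apply: eq_bigr => i _.
rewrite coef_map /= !rmorphM rmorphB !rmorphXn /= rmorphM rmorphN /= -mulrBr.
rewrite -{1}(subnK (ltnW (ltn_ord i))) exprD.
transitivity ((g`_i)%:~R * b%:~R ^+ (size g - i) *
  ((b%:~R * - (a%:~R / b%:~R)) ^+ i - (b%:~R * K%:R) ^+ i) : rat).
  by rewrite !exprMn; ring.
by rewrite mulrN mulrCA divff // mulr1.
Qed.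

Theorem ratcong0_reduction (l e a b d n : nat) : prime l -> (0 < e)%N -> (0 < b)%N ->
  coprime b l -> (l ^ e %| a + b * d)%N ->
  (forall c, ((l ^ e)%N%:Z %| cf (euler ^+ (d + l ^ e * c))%R n)%Z) ->
  ratcong0 (l ^ e) (p (- (a%:R / b%:R)) n).
Proof.
move=> l_pr e0 b0 cop abd H; have l0 := prime_gt0 l_pr.
have [g [D D0 Pg]] := rat_poly_scale (part_poly n n).
(* The denominators of the polynomial may contain l^t, because of the factorials, so K must
   approximate -a/b modulo l^(t+e) and not merely modulo l^e. *)
have [m cm Dm] : {m | coprime l m & `|D|%N = (m * l ^ logn l `|D|)%N}.
  by apply: pfactor_coprime => //; rewrite absz_gt0.
set t := logn l _ in Dm; pose L := (l ^ (t + e))%N; pose D1 := (-1) ^+ (D < 0)%R * m%:Z.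
have DE : D = D1 * (l ^ t)%N%:Z.
  by rewrite /D1 -mulrA -PoszM -Dm; apply: intEsign.
have L0 : (0 < L)%N by rewrite expn_gt0 l0.
case: (egcdnP L b0) => u v uv _.
have copL : gcdn b L = 1%N by apply/eqP; rewrite -/(coprime _ _) coprimeXr.
rewrite copL in uv.
(* u inverts b modulo L and a(L - 1) stands for -a, so bK = -a modulo L; the summand dL only ensures
   d <= K. *)
pose K := (a * (L - 1) * u + d * L)%N.
have LK : (L %| a + b * K)%N.
  apply/dvdnP; exists (a * (1 + (L - 1) * v) + b * d)%N.
  rewrite /K mulnDr [(b * (a * (L - 1) * u))%N](_ : _ = a * (L - 1) * (u * b))%N; last by ring.
  have key x : (a + (a * x * (v * (x + 1) + 1) + b * (d * (x + 1))) =
    (a * (1 + x * v) + b * d) * (x + 1))%N by ring.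
  by have := key (L - 1)%N; rewrite subnK // uv.
have dK : (d <= K)%N by apply: leq_trans (leq_addl _ _); rewrite leq_pmulr.
have le_L : (l ^ e %| L)%N by rewrite /L expnD dvdn_mull.
have [c Kc] : exists c, K = (d + l ^ e * c)%N.
  have : (l ^ e %| b * (K - d))%N.
    rewrite mulnBr -(subnDl a) dvdn_sub //; exact: dvdn_trans LK.
  rewrite Gauss_dvdr; last by rewrite coprime_sym coprimeXr.
  by case/dvdnP => c ec; exists c; rewrite mulnC -ec subnKC.
have /dvdzP[y Hy] := H c; rewrite -Kc in Hy.
have /dvdnP[w Hw] := LK.
have [|z Hz] := @int_poly_diff g a%:Z b%:Z K; first by rewrite eqz_nat; lia.
have D0' : D%:~R != 0 :> rat by rewrite intr_eq0.
have E (x : rat) : (map_poly intr g).[x] = D%:~R * p x n.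
  by rewrite p_polyE Pg hornerZ mulrA mulfV // mul1r.
rewrite !E p_nat Hy -mulrBr in Hz.
have cD : coprimez D1 (l ^ e)%N.
  by rewrite coprimezE /D1 abszM absz_sign mul1n /= coprimeXr // coprime_sym.
clearbody D1.
apply: (@ratcong0_frac _ (w%:Z * z + b%:Z ^+ size g * D1 * y) (b%:Z ^+ size g * D1)).
- rewrite mulf_neq0 ?expf_neq0 ?eqz_nat -?lt0n //; apply: contraNneq D0 => D10.
  by rewrite DE D10 mul0r.
- by rewrite coprimezMl cD coprimezXl // coprimezE /= coprimeXr.
have lt0 : ((l ^ t)%N%:Z)%:~R != 0 :> rat by rewrite intr_eq0 eqz_nat -lt0n expn_gt0 l0.
apply: (mulfI lt0).
move: Hz; rewrite DE -PoszM -PoszD Hw /L expnD.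
have -> : p (- (a%:R / b%:R)) n = p (- ((a%:Z)%:~R / (b%:Z)%:~R)) n by [].
rewrite !(PoszM, intrM, intrD) [(b%:Z ^+ _)%:~R]rmorphXn /=.
move: (p _ n) ((l ^ t)%N%:Z%:~R) ((l ^ e)%N%:Z%:~R) => P T U Hz.
transitivity (b%:~R ^+ size g * (D1%:~R * T * (P - y%:~R * U))
  + b%:~R ^+ size g * D1%:~R * T * y%:~R * U); first by ring.
by rewrite Hz; ring.
Qed.

(** * The congruences *)

Lemma ratcong0_class (l e a b d r n : nat) :
  [&& prime l, (0 < e)%N, (0 < b)%N, coprime b l & (l ^ e %| a + b * d)%N] -> (r < l)%N ->
  (forall m, (m %% l = r)%N -> ((l ^ e)%N%:Z %| cf (euler ^+ d)%R m)%Z) ->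
  ratcong0 (l ^ e) (p (- (a%:R / b%:R)) (l * n + r)).
Proof.
case/and5P => l_pr e0 b0 cop abd rl H; apply: ratcong0_reduction abd _ => // c.
by apply: (euler_pow_class c l_pr e0 H); rewrite mulnC modnMDl modn_small.
Qed.

Lemma ratcong0_euler (l a b n : nat) (rs : seq nat) :
  [&& prime l, (0 < b)%N, coprime b l, (l %| a + b * 1)%N
    & all (fun r => (r < l)%N &&
        all (fun x => x ^ 2 %% l != (24 * r + 1) %% l)%N (iota 0 l)) rs] ->
  forall r, r \in rs -> ratcong0 l (p (- (a%:R / b%:R)) (l * n + r)).
Proof.
case/and5P => l_pr b0 cop abd /allP H r /H/andP[rl nsq].
apply: (@ratcong0_class l 1 a b 1) => //; first by rewrite l_pr b0 cop.
by move=> m mr; rewrite expr1 (euler_class_eq0 (prime_gt0 l_pr) nsq mr) dvdz0.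
Qed.

Lemma ratcong0_cube (l a b n : nat) (rs : seq nat) :
  [&& prime l, (0 < b)%N, coprime b l, (l %| a + b * 3)%N
    & all (fun r => (r < l)%N &&
        all (fun x => (x ^ 2 %% l == (8 * r + 1) %% l) ==> (x == 0))%N (iota 0 l)) rs] ->
  forall r, r \in rs -> ratcong0 l (p (- (a%:R / b%:R)) (l * n + r)).
Proof.
case/and5P => l_pr b0 cop abd /allP H r /H/andP[rl sq].
apply: (@ratcong0_class l 1 a b 3) => //; first by rewrite l_pr b0 cop.
exact: euler_cube_class_dvd (prime_gt0 l_pr) sq.
Qed.

Lemma ratcong0_check (l a b u v n3 n1 r k n : nat) :
  check_case l u v n3 n1 r k ->
  [&& (0 < b)%N, coprime b l & (l %| a + b * (2 * (3 * u + v)))%N] ->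
  ratcong0 l (p (- (a%:R / b%:R)) (l * n + r)).
Proof.
move=> chk /and3P[b0 cop abd].
have /and5P[l_pr _ rl lr _] := chk.
apply: (@ratcong0_class l 1 a b (2 * (3 * u + v))) => //; first by rewrite l_pr b0 cop.
move=> m mr; apply: (check_caseP chk).
by rewrite (divn_eq m l) mr mulnDr mulnA -addnA dvdn_addr // dvdn_mull.
Qed.

Unset Implicit Arguments.

Theorem theorem3p2 (n : nat) :
     (forall r : nat, r \in [:: 2%N; 4%N; 5%N; 6%N] ->
      ratcong0 7 (p (- (1 / 2)) (7 * n + r)))
  /\ (forall r : nat, r \in [:: 20%N; 34%N; 41%N; 48%N] ->
      ratcong0 49 (p (- (1 / 2)) (49 * n + r)))
  /\ ratcong0 17 (p (- (1 / 2)) (17 * n + 11))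
  /\ ratcong0 29 (p (- (1 / 2)) (29 * n + 26))
  /\ (forall r : nat, r \in [:: 2%N; 3%N; 4%N] ->
      ratcong0 5 (p (- (1 / 3)) (5 * n + r)))
  /\ ratcong0 25 (p (- (1 / 3)) (5 * n + 3))
  /\ ratcong0 19 (p (- (1 / 3)) (19 * n + 14))
  /\ ratcong0 31 (p (- (1 / 3)) (31 * n + 28))
  /\ (forall r : nat, r \in [:: 3%N; 4%N] ->
      ratcong0 5 (p (- (2 / 3)) (5 * n + r)))
  /\ (forall r : nat, r \in [:: 2%N; 4%N; 5%N; 7%N; 8%N; 9%N] ->
      ratcong0 11 (p (- (2 / 3)) (11 * n + r)))
  /\ (forall r : nat, r \in [:: 3%N; 4%N] ->
      ratcong0 5 (p (- (1 / 4)) (5 * n + r)))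
  /\ (forall r : nat, r \in [:: 4%N; 5%N; 7%N; 8%N; 9%N; 11%N; 12%N] ->
      ratcong0 13 (p (- (1 / 4)) (13 * n + r)))
  /\ (forall r : nat, r \in [:: 2%N; 3%N; 4%N] ->
      ratcong0 5 (p (- (3 / 4)) (5 * n + r)))
  /\ ratcong0 43 (p (- (3 / 4)) (43 * n + 39))
  /\ ratcong0 59 (p (- (3 / 4)) (59 * n + 24))
  /\ ratcong0 107 (p (- (3 / 4)) (107 * n + 97))
  /\ ratcong0 31 (p (- (1 / 5)) (31 * n + 23))
  /\ ratcong0 71 (p (- (1 / 5)) (71 * n + 29))
  /\ ratcong0 131 (p (- (1 / 5)) (131 * n + 119))
  /\ (forall r : nat, r \in [:: 3%N; 4%N; 6%N] ->
      ratcong0 7 (p (- (2 / 5)) (7 * n + r)))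
  /\ ratcong0 11 (p (- (2 / 5)) (11 * n + 9))
  /\ (forall r : nat, r \in [:: 2%N; 5%N; 7%N; 8%N; 9%N; 12%N; 13%N; 14%N; 16%N] ->
      ratcong0 17 (p (- (2 / 5)) (17 * n + r)))
  /\ ratcong0 11 (p (- (3 / 5)) (11 * n + 8))
  /\ ratcong0 11 (p (- (4 / 5)) (11 * n + 7))
  /\ (forall r : nat, r \in [:: 4%N; 5%N; 7%N; 8%N; 11%N; 12%N; 13%N; 14%N; 16%N; 18%N] ->
      ratcong0 19 (p (- (4 / 5)) (19 * n + r))).
Proof.
(* Each case picks d with l^e | a + b d: here 7 = 1 + 2 * 3, below 49 = 1 + 2 * 24 and 25 = 1 + 3 *
   8. *)
split; first exact: (@ratcong0_cube 7 1 2).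
split.
  move=> r r4; apply: (@ratcong0_reduction 7 2 1 2 24) => // c.
  (* The residues have the form 7s + 6, with s among 2, 4, 5, 6. *)
  have rs : (r \in [:: 7 * 2 + 6; 7 * 4 + 6; 7 * 5 + 6; 7 * 6 + 6])%N by [].
  move: rs; rewrite !inE => /or4P[] /eqP ->.
  - by apply: (@euler24_class c _ 2); rewrite // mulnC modnMDl.
  - by apply: (@euler24_class c _ 4); rewrite // mulnC modnMDl.
  - by apply: (@euler24_class c _ 5); rewrite // mulnC modnMDl.
  - by apply: (@euler24_class c _ 6); rewrite // mulnC modnMDl.
(* 17 = 1 + 2 * 8 with 8 = 2(3 * 1 + 1); the last argument is large enough for r + l(k + 1) to pass
   the weight bound (4 + 2l)l / 12. *)
split; first by apply: (@ratcong0_check 17 1 2 1 1 10 5 11 2); vm_compute.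
split; first by apply: (@ratcong0_check 29 1 2 2 1 17 9 26 4); vm_compute.
split; first exact: (@ratcong0_cube 5 1 3).
split; first by apply: (@ratcong0_class 5 2 1 3 8) => // m; apply: euler8_class.
split; first by apply: (@ratcong0_check 19 1 3 1 0 10 6 14 2); vm_compute.
split; first by apply: (@ratcong0_check 31 1 3 1 2 17 10 28 4); vm_compute.
split; first exact: (@ratcong0_euler 5 2 3).
split; first exact: (@ratcong0_cube 11 2 3).
split; first exact: (@ratcong0_euler 5 1 4).
split; first exact: (@ratcong0_cube 13 1 4).
split; first exact: (@ratcong0_cube 5 3 4).
split; first by apply: (@ratcong0_check 43 3 4 1 2 24 14 39 6); vm_compute.
split; first by apply: (@ratcong0_check 59 3 4 2 1 33 19 24 9); vm_compute.
split; first by apply: (@ratcong0_check 107 3 4 4 1 62 35 97 17); vm_compute.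
split; first by apply: (@ratcong0_check 31 1 5 1 0 17 10 23 4); vm_compute.
split; first by apply: (@ratcong0_check 71 1 5 2 1 40 23 29 11); vm_compute.
split; first by apply: (@ratcong0_check 131 1 5 4 1 76 43 119 21); vm_compute.
split; first exact: (@ratcong0_euler 7 2 5).
split; first by apply: (@ratcong0_check 11 2 5 0 2 6 3 9 1); vm_compute.
split; first exact: (@ratcong0_cube 17 2 5).
split; first by apply: (@ratcong0_check 11 3 5 1 0 6 3 8 1); vm_compute.
split; first by apply: (@ratcong0_check 11 4 5 1 1 6 3 7 1); vm_compute.
exact: (@ratcong0_cube 19 4 5).
Qed.
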